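(* Let $\mathbf K$ be an algebraically closed field of characteristic $0$. Fix non-negative integers $d,x,y,z$ with $9\le d\le 13$. Let $Y\subset\mathbf P^3$ be a general union of $x$ $4$-points, $y$ $3$-points and $z$ $2$-points. Then $Y$ has good postulation in degree $d$: if $20x+10y+4z\le\binom{d+3}{3}$ then $h^1(\mathbf P^3,\mathcal I_Y(d))=0$, and if $20x+10y+4z\ge\binom{d+3}{3}$ then $h^0(\mathbf P^3,\mathcal I_Y(d))=0$.
   Context: For a point $P\in\mathbf P^3$ and $m\ge1$, the $m$-point $mP$ is the subscheme with ideal sheaf $(\mathcal I_{P})^m$, of length $\binom{m+2}{3}$. A general union means the supporting points are general points of $\mathbf P^3$. $\mathcal I_Y(d)$ is the ideal sheaf of $Y$ twisted by $\mathcal O_{\mathbf P^3}(d)$. *)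

(* Defs.v *)
From HB Require Import structures.
From mathcomp Require Import all_boot all_order all_algebra.
Set Implicit Arguments. Unset Strict Implicit. Unset Printing Implicit Defensive.
Import GRing.Theory.
Local Open Scope ring_scope.

(* Exponent vectors of monomials of degree d in the 4 homogeneous
   coordinates X_0..X_3 of P^3; they index a basis of H^0(O_{P^3}(d)). *)
Definition Mon (d : nat) :=
  {e : {ffun 'I_4 -> 'I_d.+1} | (\sum_(i < 4) (e i : nat) == d)%N}.

(* Multi-indices of partial derivatives (orders <= d suffice). *)
Definition DerIdx (d : nat) := {ffun 'I_4 -> 'I_d.+1}.

Definition mult (x y : nat) (j : nat) : nat :=
  if (j < x)%N then 4%N else if (j < x + y)%N then 3%N else 2%N.

(* The interpolation matrix: row beta (monomial X^beta), column (j, alpha);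
   the entry is (d^alpha X^beta)(P_j) if |alpha| < mult j, and 0 otherwise.
   For a form f = sum_beta c_beta X^beta, the row vector c *m M lists the
   partial derivatives of order < m_j of f at P_j; f lies in
   H^0(I_Y(d)) iff c *m M = 0 (char 0). *)
Definition interp_mx (K : fieldType) (d x y z : nat)
    (P : 'I_(x + y + z) -> 'I_4 -> K) :
    'M[K]_(#|{: Mon d}|, #|{: 'I_(x + y + z) * DerIdx d}|) :=
  \matrix_(r, c)
    let beta : {ffun 'I_4 -> 'I_d.+1} := val (enum_val r : Mon d) in
    let jc : 'I_(x + y + z) * DerIdx d := enum_val c in
    let j : 'I_(x + y + z) := jc.1 in
    let alpha : {ffun 'I_4 -> 'I_d.+1} := jc.2 in
    if (\sum_(i < 4) (alpha i : nat) < mult x y j)%N then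
      \prod_(i < 4) ((((beta i : nat) ^_ (alpha i : nat))%N)%:R
                       * P j i ^+ ((beta i : nat) - alpha i))
    else 0.

Definition h0_IY (K : fieldType) (d x y z : nat)
    (P : 'I_(x + y + z) -> 'I_4 -> K) : nat :=
  (#|{: Mon d}| - \rank (@interp_mx K d x y z P))%N.

Definition lengthY (x y z : nat) : nat :=
  (\sum_(j < x + y + z) 'C(mult x y j + 2, 3))%N.

(* h^1(P^3, I_Y(d)) = coker of H^0(O(d)) -> H^0(O_Y(d)) (since
   h^1(O_{P^3}(d)) = 0): length Y - rank of the restriction map. *)
Definition h1_IY (K : fieldType) (d x y z : nat)
    (P : 'I_(x + y + z) -> 'I_4 -> K) : nat :=
  (lengthY x y z - \rank (@interp_mx K d x y z P))%N.

Definition peval (K : fieldType) (V : finType)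
    (G : seq (K * {ffun V -> nat})) (v : V -> K) : K :=
  \sum_(t <- G) t.1 * \prod_(i : V) v i ^+ t.2 i.

(* Q holds for a general point of the affine space K^V: it holds on a
   nonempty Zariski open subset {G != 0}. *)
Definition general (K : fieldType) (V : finType) (Q : (V -> K) -> Prop) : Prop :=
  exists G : seq (K * {ffun V -> nat}),
    (exists v, peval G v != 0) /\ (forall v, peval G v != 0 -> Q v).

(* Main.v *)
(* A toric degeneration.  Group the points, and multiply the coordinates of the
   points of group [k] by [s ^ lam_k] (coordinatewise), where [s] is a parameter and
   [lam_k] a vector of exponents.  After rescaling rows and columns, the
   interpolation matrix is polynomial in [s], and at [s = 0] an entry in the row of
   the monomial [a] and in a column of group [k] survives only if [k] minimises
   [<lam_k, a>].  If every minimum is attained once, the monomials of degree d split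
   into cells (a power diagram) and the limit matrix is block diagonal: the block of
   cell [k] consists of the conditions of group [k] on the monomials of cell [k].
   For each d from 9 to 13 there is such a partition in which every cell but the last
   has 20m monomials, m = 2, 3 or 4, and its block is invertible whenever its group
   consists of i 4-points, 2j 3-points and 5l 2-points with i + j + l = m, while the
   block of the last cell has maximal rank for every group that can remain.  Any
   (x, y, z) is then distributed greedily: 4-points first, then pairs of 3-points,
   then quintuples of 2-points.  The rank of a block of integers is at least its rank
   modulo 31, where it is computed by elimination.  Lower bounds on ranks are open
   conditions, so one set of points is enough. *)
From Stdlib Require Import NArith.
Require Import Defs.
From HB Require Import structures.
From mathcomp Require Import all_boot all_order all_algebra.
From mathcomp Require Import zify ring.
Import GRing.Theory.
Set Implicit Arguments. Unset Strict Implicit. Unset Printing Implicit Defensive.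

(** * Elimination modulo 31 and the configurations *)

(* An enumerated type with tabulated operations: the blocks below are eliminated by
   plain kernel reduction, and a table look-up is a single match. *)
Inductive F31 :=
  | e0 | e1 | e2 | e3 | e4 | e5 | e6 | e7 | e8 | e9 | e10 | e11 | e12 | e13
  | e14 | e15 | e16 | e17 | e18 | e19 | e20 | e21 | e22 | e23 | e24 | e25 | e26 | e27
  | e28 | e29 | e30.

Definition F31_elim (A : Type) (f : F31 -> A) (x : F31) : A :=
  match x with
  | e0 => f e0 | e1 => f e1 | e2 => f e2 | e3 => f e3 | e4 => f e4 | e5 => f e5
  | e6 => f e6 | e7 => f e7 | e8 => f e8 | e9 => f e9 | e10 => f e10 | e11 => f e11
  | e12 => f e12 | e13 => f e13 | e14 => f e14 | e15 => f e15 | e16 => f e16 | e17 => f e17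
  | e18 => f e18 | e19 => f e19 | e20 => f e20 | e21 => f e21 | e22 => f e22 | e23 => f e23
  | e24 => f e24 | e25 => f e25 | e26 => f e26 | e27 => f e27 | e28 => f e28 | e29 => f e29
  | e30 => f e30
  end.

Definition F31_enum := [:: e0; e1; e2; e3; e4; e5; e6; e7; e8; e9; e10; e11; e12; e13;
  e14; e15; e16; e17; e18; e19; e20; e21; e22; e23; e24; e25; e26; e27; e28; e29; e30].

Definition nat_of_F31 (x : F31) : nat :=
  match x with
  | e0 => 0 | e1 => 1 | e2 => 2 | e3 => 3 | e4 => 4 | e5 => 5 | e6 => 6
  | e7 => 7 | e8 => 8 | e9 => 9 | e10 => 10 | e11 => 11 | e12 => 12 | e13 => 13
  | e14 => 14 | e15 => 15 | e16 => 16 | e17 => 17 | e18 => 18 | e19 => 19 | e20 => 20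
  | e21 => 21 | e22 => 22 | e23 => 23 | e24 => 24 | e25 => 25 | e26 => 26 | e27 => 27
  | e28 => 28 | e29 => 29 | e30 => 30
  end.

Definition F31_of_nat (k : nat) : F31 := nth e0 F31_enum (k %% 31).

Definition F31_add := Eval vm_compute in fun x y =>
  F31_elim (fun x => F31_elim (fun y => F31_of_nat (nat_of_F31 x + nat_of_F31 y)) y) x.

Definition F31_mul := Eval vm_compute in fun x y =>
  F31_elim (fun x => F31_elim (fun y => F31_of_nat (nat_of_F31 x * nat_of_F31 y)) y) x.

(* The opposite of the inverse; the junk value at [e0] is [e0]. *)
Definition F31_oppinv := Eval vm_compute in
  F31_elim (fun x => nth e0 F31_enum
    (find (fun y => (nat_of_F31 x * nat_of_F31 y).+1 %% 31 == 0) F31_enum)).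

Fixpoint axpy (f : F31) (p r : seq F31) : seq F31 :=
  match p, r with
  | a :: p', b :: r' => F31_add b (F31_mul f a) :: axpy f p' r'
  | _, _ => [::]
  end.

(** It is called with [f] the opposite of the inverse of the pivot, so that adding [y * f] times [p]
    cancels the head [y]. *)
Definition clear_head (f : F31) (p r : seq F31) : seq F31 :=
  match r with
  | [::] => [::]
  | e0 :: r' => r'
  | y :: r' => axpy (F31_mul y f) p r'
  end.

(* Eliminates the first column: [acc] holds the rows without their head that were
   skipped because this head is zero.  [None] means that there is no pivot. *)
Fixpoint eliminate (acc rows : seq (seq F31)) : option (seq (seq F31)) :=
  match rows with
  | [::] | [::] :: _ => None
  | (e0 :: r) :: rows' => eliminate (r :: acc) rows'
  | (x :: r) :: rows' =>
      Some (catrev acc (map (clear_head (F31_oppinv x) r) rows'))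
  end.

Fixpoint col_free (n : nat) (rows : seq (seq F31)) : bool :=
  match n with
  | 0 => true
  | n'.+1 => if eliminate [::] rows is Some rows' then col_free n' rows' else false
  end.

Definition quad := (nat * nat * nat * nat)%type.

Definition monomials (d : nat) : seq quad :=
  [seq (d - (ab.1 + ab.2 + c), ab.1, ab.2, c)
    | ab <- [seq (a, b) | a <- iota 0 d.+1, b <- iota 0 (d - a).+1],
      c <- iota 0 (d - (ab.1 + ab.2)).+1].

(* The affine derivations of order less than [m] (for [m] in [2, 3, 4]), that is,
   those without derivative along [X_0]; sorted by order, so that the list for [m] is
   a prefix. *)
Definition ders (m : nat) : seq (nat * nat * nat) :=
  take 'C(m + 2, 3)
    [:: (0, 0, 0); (0, 0, 1); (0, 1, 0); (1, 0, 0); (0, 0, 2); (0, 1, 1); (0, 2, 0); (1,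
  0, 1); (1, 1, 0); (2, 0, 0); (0, 0, 3); (0, 1, 2); (0, 2, 1); (0, 3, 0); (1, 0, 2);
  (1, 1, 1); (1, 2, 0); (2, 0, 1); (2, 1, 0); (3, 0, 0)].

Fixpoint F31_exp (q : F31) (k : nat) : F31 :=
  if k is k'.+1 then F31_mul q (F31_exp q k') else e1.

Fixpoint power_der (q : F31) (a b : nat) : F31 :=
  match b, a with
  | 0, _ => F31_exp q a
  | _.+1, 0 => e0
  | b'.+1, a'.+1 => F31_mul (F31_of_nat a) (power_der q a' b')
  end.

(* Exponents up to 13 and orders up to 3 are enough. *)
Definition power_ders := Eval vm_compute in
  F31_elim (fun q => [seq [seq power_der q a b | b <- iota 0 4] | a <- iota 0 14]).

Definition jet (m : nat) (a : quad) (q : F31 * F31 * F31) : seq F31 :=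
  let: (_, a1, a2, a3) := a in
  let: (q1, q2, q3) := q in
  let r1 := nth [::] (power_ders q1) a1 in
  let r2 := nth [::] (power_ders q2) a2 in
  let r3 := nth [::] (power_ders q3) a3 in
  [seq (let: (b1, b2, b3) := b in
        F31_mul (nth e0 r1 b1) (F31_mul (nth e0 r2 b2) (nth e0 r3 b3))) | b <- ders m].

(* The coordinates [X_1, X_2, X_3] of random points with [X_0 = 1]. *)
Definition points : seq (F31 * F31 * F31) := [::
    (e16,e6,e24); (e19,e10,e7); (e29,e24,e14); (e25,e23,e25); (e9,e18,e8);
  (e21,e27,e24); (e16,e12,e14); (e17,e24,e20); (e7,e10,e18); (e23,e11,e17);
  (e3,e24,e25); (e28,e7,e23); (e25,e24,e15); (e30,e23,e27); (e28,e21,e5); (e18,e7,e28);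
  (e14,e2,e25); (e12,e21,e14); (e15,e4,e24); (e24,e5,e25); (e11,e13,e11); (e12,e26,e7);
  (e11,e14,e14); (e11,e19,e7); (e29,e28,e14); (e8,e7,e2); (e24,e8,e25); (e1,e28,e9);
  (e28,e17,e11); (e25,e19,e26); (e23,e14,e20); (e4,e11,e28); (e21,e20,e25); (e8,e8,e15);
  (e12,e5,e7); (e12,e16,e20); (e27,e21,e5); (e9,e13,e20); (e11,e11,e23); (e23,e15,e28);
  (e6,e22,e23); (e25,e28,e5); (e11,e30,e7); (e19,e22,e3); (e4,e27,e6); (e1,e29,e5);
  (e15,e23,e8); (e12,e8,e3); (e7,e26,e10); (e8,e23,e15); (e20,e9,e16); (e17,e29,e14);
  (e22,e14,e7); (e27,e3,e10); (e10,e9,e5); (e19,e22,e24); (e9,e17,e4); (e16,e7,e29);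
  (e7,e26,e13); (e6,e17,e28)].

Definition point (i : nat) := nth (e1, e1, e1) points i.

(* The conditions imposed on a monomial by the points used in a cell, which are read
   in [points] from position [s] on.  At most 6 4-points, 10 3-points and 24 2-points
   occur in a cell, hence the shifts. *)
Definition jets (s : nat) (a : quad) :=
  ([seq jet 4 a (point (s + i)) | i <- iota 0 6],
   [seq jet 3 a (point (s + 6 + i)) | i <- iota 0 10],
   [seq jet 2 a (point (s + 16 + i)) | i <- iota 0 24]).

(* The numbers of 4-points, 3-points and 2-points put into a cell. *)
Definition content := (nat * nat * nat)%type.

Definition content_length (t : content) : nat := let: (a, b, c) := t in 20 * a + 10 * b + 4 * c.

Definition content_row (t : content) (p : seq (seq F31) * seq (seq F31) * seq (seq F31)) :=
  let: (a, b, c) := t in let: (u, v, w) := p in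
  flatten (take a u ++ take b v ++ take c w).

Fixpoint transpose (n : nat) (rows : seq (seq F31)) : seq (seq F31) :=
  if n is n'.+1 then map (head e0) rows :: transpose n' (map behead rows) else [::].

Definition content_ok (n : nat) (J : seq (seq (seq F31) * seq (seq F31) * seq (seq F31)))
    (t : content) : bool :=
  let: (a, b, c) := t in
  let rows := map (content_row t) J in
  let l := content_length t in
  [&& a <= 6, b <= 10, c <= 24 &
      if l <= n then col_free l rows else col_free n (transpose l rows)].

Definition pure_contents (m : nat) : seq content :=
  flatten [seq [seq (i, 2 * j, 5 * (m - (i + j))) | j <- iota 0 (m - i).+1] | i <- iota 0 m.+1].

(* The contents to be checked in the last cell, of size [r]: length at most [r] with no
   room for another 2-point, or length at least [r] with no point to spare. *)
Definition tight (r : nat) (t : content) : bool :=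
  let: (a, b, c) := t in
  let l := content_length t in
  (l <= r < l + 4) ||
  [&& r <= l, (a == 0) || (l < r + 20), (b == 0) || (l < r + 10) & (c == 0) || (l < r + 4)].

Definition mixed_contents (r : nat) : seq content :=
  [seq t <- flatten [seq flatten [seq [seq (a, b, c) | c <- iota 0 (r %/ 4).+2]
     | b <- iota 0 (r %/ 10).+2] | a <- iota 0 (r %/ 20).+2] | tight r t].

Definition weightN (l : N * N * N * N) (a : quad) : N :=
  let: (l0, l1, l2, l3) := l in let: (a0, a1, a2, a3) := a in
  (l0 * N.of_nat a0 + l1 * N.of_nat a1 + l2 * N.of_nat a2 + l3 * N.of_nat a3)%num.

Definition min_weight (ls : seq (N * N * N * N)) (a : quad) : N :=
  let ws := [seq weightN l a | l <- ls] in foldr N.min (head 0%num ws) ws.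

(* The index of the least weight, with junk value [size ls] if it is not unique. *)
Definition owner (ls : seq (N * N * N * N)) (a : quad) : nat :=
  let ws := [seq weightN l a | l <- ls] in
  let w := foldr N.min (head 0%num ws) ws in
  if [seq k <- iota 0 (size ws) | N.eqb (nth 0%num ws k) w] is [:: k] then k else size ws.

Definition owners (ls : seq (N * N * N * N)) (d : nat) := [seq (owner ls a, a) | a <- monomials d].

Definition cell (os : seq (nat * quad)) (k : nat) : seq quad :=
  [seq o.2 | o <- os & eqn o.1 k].

Definition cell_ok (os : seq (nat * quad)) (n : nat) (k s : nat) (ts : seq content) : bool :=
  let c := cell os k in
  eqn (size c) n && (let J := map (jets s) c in all (content_ok n J) ts).

(* [ls]: the exponents [lam_k]; [20 * m] for [m] in [ms], then [r]: the sizes of the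
   cells; [ss]: the positions in [points] from which the points of a cell are read. *)
Definition config_ok (d : nat) (ls : seq (N * N * N * N)) (ms ss : seq nat) (r : nat) : bool :=
  let os := owners ls d in
  [&& eqn (size ls) (size ms).+1, eqn (20 * sumn ms + r) 'C(d + 3, 3), 20 <= r,
      all (fun o => o.1 < size ls) os,
      all (fun k => cell_ok os (20 * nth 0 ms k) k (nth 0 ss k) (pure_contents (nth 0 ms k)))
          (iota 0 (size ms)) &
      cell_ok os r (size ms) (nth 0 ss (size ms)) (mixed_contents r)].

(* The configurations were found by simulated annealing on power diagrams. *)
Definition weights9 : seq (N * N * N * N) := [::
  (276, 154, 111, 0)%num;
  (210, 48, 224, 20)%num;
  (77, 0, 222, 186)%num;
  (0, 39, 189, 302)%num;
  (70, 182, 0, 254)%num].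
Definition sizes9 : seq nat := [:: 2; 2; 2; 2].
Definition seeds9 : seq nat := [:: 3; 1; 1; 2; 3].

Definition weights10 : seq (N * N * N * N) := [::
  (89, 0, 89, 53)%num;
  (113, 107, 0, 42)%num;
  (76, 41, 111, 0)%num;
  (0, 128, 118, 33)%num].
Definition sizes10 : seq nat := [:: 4; 4; 3].
Definition seeds10 : seq nat := [:: 6; 3; 1; 1].

Definition weights11 : seq (N * N * N * N) := [::
  (135, 0, 337, 147)%num;
  (0, 242, 178, 19)%num;
  (93, 224, 69, 1)%num;
  (70, 195, 112, 0)%num;
  (92, 270, 0, 104)%num].
Definition sizes11 : seq nat := [:: 4; 4; 3; 3].
Definition seeds11 : seq nat := [:: 0; 0; 0; 0; 15].

Definition weights12 : seq (N * N * N * N) := [::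
  (0, 1893, 3720, 7904)%num;
  (2091, 5625, 0, 5555)%num;
  (883, 4699, 921, 5843)%num;
  (1591, 0, 7237, 7551)%num;
  (2371, 2628, 1416, 5932)%num;
  (12251, 7550, 3209, 0)%num].
Definition sizes12 : seq nat := [:: 4; 4; 4; 4; 3].
Definition seeds12 : seq nat := [:: 4; 3; 0; 5; 0; 3].

Definition weights13 : seq (N * N * N * N) := [::
  (217, 449, 20, 437)%num;
  (383, 498, 220, 67)%num;
  (0, 654, 487, 406)%num;
  (550, 0, 422, 320)%num;
  (699, 288, 424, 0)%num;
  (456, 58, 248, 404)%num;
  (488, 252, 51, 278)%num;
  (330, 370, 0, 387)%num].
Definition sizes13 : seq nat := [:: 4; 4; 4; 4; 3; 3; 3].
Definition seeds13 : seq nat := [:: 0; 0; 8; 4; 0; 3; 0; 1].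

Local Open Scope ring_scope.

(** * Ranks *)

(** Rank bounds become the nonvanishing of one determinant of a compression of [A]. Determinants
    commute with ring morphisms and are polynomial in the entries, so specialization, reduction
    modulo a prime and genericity can all be read off from it. *)
Lemma rank_geP (F : fieldType) m n r (A : 'M[F]_(m, n)) :
  reflect (exists (U : 'M_(r, m)) (V : 'M_(n, r)), \det (U *m A *m V) != 0)
          (r <= \rank A)%N.
Proof.
apply: (iffP idP) => [le_r | [U [V dUV]]]; last first.
  have: U *m A *m V \in unitmx by rewrite unitmxE unitfE.
  rewrite -row_free_unit /row_free => /eqP <-.
  apply: leq_trans (mxrankM_maxl _ _) _; exact: mxrankM_maxr.
exists (pid_mx r *m invmx (col_ebase A)), (invmx (row_ebase A) *m pid_mx r).
rewrite -[X in _ *m X *m _](mulmx_ebase A) !mulmxA.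
rewrite mulmxKV ?col_ebase_unit // mulmxK ?row_ebase_unit //.
rewrite !mul_pid_mx.
have -> : minn n (minn (minn m (minn r (\rank A))) r) = r.
  have lem := leq_trans le_r (rank_leq_row A).
  have len := leq_trans le_r (rank_leq_col A).
  by rewrite (minn_idPl le_r) (minn_idPr lem) minnn (minn_idPr len).
by rewrite pid_mx_1 det1 oner_eq0.
Qed.

Lemma pchar0_natr_inj (F : fieldType) : [pchar F] =i pred0 ->
  injective (fun n : nat => n%:R : F).
Proof.
move=> F0; have nat0 n : (n%:R == 0 :> F) = (n == 0)%N by have /(pcharf0P) -> := F0.
move=> m n /eqP; wlog le_mn : m n / (m <= n)%N => [W | ].
  by case: (leqP m n) => [/W//| /ltnW/W E]; rewrite eq_sym => /E.
by rewrite eq_sym -subr_eq0 -natrB // nat0 subn_eq0 => le_nm; apply/eqP; rewrite eqn_leq le_mn.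
Qed.

(** A compression that is invertible at 0 has as determinant a polynomial [q] with nonzero value at
    0; every [s] outside its finitely many roots keeps the rank. *)
Lemma rank_specialize (F : fieldType) m n (A : 'M[{poly F}]_(m, n)) :
  [pchar F] =i pred0 ->
  exists2 s : F, s != 0 &
    (\rank (map_mx (horner_eval 0) A) <= \rank (map_mx (horner_eval s) A))%N.
Proof.
move=> F0; set r := \rank _.
have /rank_geP [U [V dUV]] : (r <= \rank (map_mx (horner_eval 0) A))%N by [].
pose q : {poly F} := \det (map_mx polyC U *m A *m map_mx polyC V).
have q_at t : q.[t] = \det (U *m map_mx (horner_eval t) A *m V).
  rewrite -[LHS]/(horner_eval t q) -det_map_mx !map_mxM -!map_mx_comp.
  congr (\det (_ *m _ *m _)); apply/matrixP => i j;
    by rewrite !mxE /= /horner_eval hornerC.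
have q_nz : q != 0 by apply: contraNneq dUV => q0; rewrite -q_at q0 horner0.
(* [q] has fewer than [size q] roots, so one of the first [size q] positive integers, which are
   distinct and nonzero in characteristic 0, is not a root. *)
have : ~~ all (root q) [seq k.+1%:R | k <- iota 0 (size q)].
  apply/negP => /(max_poly_roots q_nz); rewrite size_map size_iota ltnn.
  by rewrite map_inj_uniq ?iota_uniq // => [/(_ isT)// | i j /(pchar0_natr_inj F0) []].
case/allPn => _ /mapP[k _ ->] qk; exists k.+1%:R.
  by have /(pcharf0P) -> := F0.
by apply/rank_geP; exists U, V; rewrite -q_at.
Qed.

(** Lift the compressing matrices to the integers: the determinant over the integers is nonzero
    because it is so modulo [p], and characteristic 0 keeps it nonzero in [F]. *)
Lemma rank_natr_mod (F : fieldType) p m n (A : 'I_m -> 'I_n -> nat) :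
  [pchar F] =i pred0 -> prime p ->
  (\rank (\matrix_(i, j) ((A i j)%:R : 'F_p))
     <= \rank (\matrix_(i, j) ((A i j)%:R : F)))%N.
Proof.
move=> F0 p_pr; set r := \rank (\matrix_(i, j) (_ : 'F_p)).
have /rank_geP [U [V]] : (r <= r)%N by [].
pose liftz k l (M : 'M['F_p]_(k, l)) : 'M[int]_(k, l) := \matrix_(i, j) (M i j : nat)%:Z.
pose Az : 'M[int]_(m, n) := \matrix_(i, j) (A i j)%:Z.
have modp k l (M : 'M['F_p]_(k, l)) : map_mx intr (liftz _ _ M) = M.
  by apply/matrixP => i j; rewrite !mxE -pmulrn natr_Zp.
have -> : \matrix_(i, j) ((A i j)%:R : 'F_p) = map_mx intr Az.
  by apply/matrixP => i j; rewrite !mxE.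
rewrite -[U]modp -[V]modp -!map_mxM det_map_mx => dz.
have {}dz : \det (liftz _ _ U *m Az *m liftz _ _ V) != 0.
  by apply: contraNneq dz => ->; rewrite rmorph0.
apply/rank_geP; exists (map_mx intr (liftz _ _ U)), (map_mx intr (liftz _ _ V)).
have -> : \matrix_(i, j) ((A i j)%:R : F) = map_mx intr Az.
  by apply/matrixP => i j; rewrite !mxE.
rewrite -!map_mxM det_map_mx; move: (\det _) dz => [] k dz.
  by change ((k%:R : F) != 0); have /(pcharf0P) -> := F0.
change (- (k.+1%:R : F) != 0).
by rewrite oppr_eq0; have /(pcharf0P) -> := F0.
Qed.

Lemma rank_ge_rows (F : fieldType) (I J : finType) (A : I -> J -> F) :
  (forall u : I -> F, (forall j, \sum_i u i * A i j = 0) -> forall i, u i = 0) ->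
  (#|I| <= \rank (\matrix_(i < #|I|, j < #|J|) A (enum_val i) (enum_val j)))%N.
Proof.
move=> Afree; set M := \matrix_(i, j) _.
suff /eqP -> : row_free M by [].
apply: inj_row_free => v vM; apply/rowP => i; rewrite mxE.
rewrite -[i]enum_valK; apply: (Afree (fun k => v 0 (enum_rank k))) => j.
have /rowP/(_ (enum_rank j)) := vM; rewrite !mxE; apply: etrans.
rewrite (reindex (@enum_val I I)) /=; last exact/onW_bij/enum_val_bij.
by apply: eq_bigr => k _; rewrite mxE enum_rankK enum_valK.
Qed.

Lemma rank_ge_cols (F : fieldType) (I J : finType) (A : I -> J -> F) (C : {pred J}) :
  (forall u : J -> F, (forall i, \sum_(j in C) A i j * u j = 0) ->
     forall j, j \in C -> u j = 0) ->
  (#|C| <= \rank (\matrix_(i < #|I|, j < #|J|) A (enum_val i) (enum_val j)))%N.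
Proof.
move=> Afree; set M := \matrix_(i, j) _.
pose N : 'M[F]_(#|I|, #|C|) := \matrix_(i, j) A (enum_val i) (enum_val j).
have NM : N = colsub (fun j => enum_rank (enum_val j)) M.
  by apply/matrixP => i j; rewrite !mxE enum_rankK.
apply: (@leq_trans (\rank N)); last first.
  rewrite NM -[X in colsub _ X]mulmx1 -mulmx_colsub; exact: mxrankM_maxl.
rewrite -mxrank_tr; suff /eqP -> : row_free N^T by [].
apply: inj_row_free => v vN; apply/rowP => j; rewrite mxE.
(* Extension of [v] by zero outside [C]: each sum has at most one term, [enum_val] being
   injective. *)
pose u k := \sum_(l | enum_val l == k) v 0 l.
have u_val l : u (enum_val l) = v 0 l.
  by rewrite /u (big_pred1 l) // => l'; rewrite (inj_eq enum_val_inj).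
rewrite -u_val; apply: Afree (enum_valP j) => i.
have /rowP/(_ (enum_rank i)) := vN; rewrite !mxE; apply: etrans.
rewrite big_enum_val; apply: eq_bigr => l _.
by rewrite !mxE enum_rankK u_val mulrC.
Qed.

(** * General points *)

Section PolynomialFunctions.
Variables (K : fieldType) (V : finType).
Implicit Types f g : (V -> K) -> K.

Definition polyfun f := exists G : seq (K * {ffun V -> nat}), forall v, peval G v = f v.

Lemma polyfun_const c : polyfun (fun=> c).
Proof.
exists [:: (c, [ffun=> 0%N])] => v; rewrite /peval big_seq1 /= big1 ?mulr1 // => i _.
by rewrite ffunE.
Qed.

Lemma polyfun_var i : polyfun (fun v => v i).
Proof.
exists [:: (1, [ffun j => (j == i) : nat])] => v; rewrite /peval big_seq1 /= mul1r.
rewrite (bigD1 i) //= ffunE eqxx expr1 big1 ?mulr1 // => j /negPf ji.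
by rewrite ffunE ji.
Qed.

Lemma polyfunD f g : polyfun f -> polyfun g -> polyfun (fun v => f v + g v).
Proof. by case=> F Ff [G Gg]; exists (F ++ G) => v; rewrite -Ff -Gg /peval big_cat. Qed.

Lemma polyfunM f g : polyfun f -> polyfun g -> polyfun (fun v => f v * g v).
Proof.
case=> F Ff [G Gg].
pose mul (s t : K * {ffun V -> nat}) :=
  (s.1 * t.1, [ffun i => (s.2 i + t.2 i)%N] : {ffun V -> nat}).
exists [seq mul st.1 st.2 | st <- [seq (s, t) | s <- F, t <- G]] => v.
rewrite -Ff -Gg /peval big_distrl big_map big_allpairs /=; apply: eq_bigr => s _.
rewrite big_distrr; apply: eq_bigr => t _ /=.
rewrite mulrACA -big_split /=; congr (_ * _); apply: eq_bigr => i _.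
by rewrite ffunE exprD.
Qed.

Lemma eq_polyfun f g : f =1 g -> polyfun f -> polyfun g.
Proof. by move=> fg [G Gf]; exists G => v; rewrite Gf. Qed.

Lemma polyfun_sum I (s : seq I) (P : pred I) (f : I -> (V -> K) -> K) :
  (forall i, polyfun (f i)) -> polyfun (fun v => \sum_(i <- s | P i) f i v).
Proof.
move=> pf; elim: s => [|i s IHs].
  by apply: eq_polyfun (polyfun_const 0) => v; rewrite big_nil.
apply: (@eq_polyfun (fun v => (if P i then f i v else 0) +
                              \sum_(j <- s | P j) f j v)) => [v|].
  by rewrite big_cons; case: (P i); rewrite ?add0r.
by apply: polyfunD => //; case: (P i) => //; apply: polyfun_const.
Qed.

Lemma polyfun_prod I (s : seq I) (P : pred I) (f : I -> (V -> K) -> K) :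
  (forall i, polyfun (f i)) -> polyfun (fun v => \prod_(i <- s | P i) f i v).
Proof.
move=> pf; elim: s => [|i s IHs].
  by apply: eq_polyfun (polyfun_const 1) => v; rewrite big_nil.
apply: (@eq_polyfun (fun v => (if P i then f i v else 1) *
                              \prod_(j <- s | P j) f j v)) => [v|].
  by rewrite big_cons; case: (P i); rewrite ?mul1r.
by apply: polyfunM => //; case: (P i) => //; apply: polyfun_const.
Qed.

Lemma polyfunX f n : polyfun f -> polyfun (fun v => f v ^+ n).
Proof.
move=> pf; elim: n => [|n IHn]; first exact: polyfun_const.
by apply: (@eq_polyfun (fun v => f v * f v ^+ n)) => [v|]; [rewrite exprS | apply: polyfunM].
Qed.

Lemma polyfun_mulmx m n p (A : (V -> K) -> 'M_(m, n)) (B : (V -> K) -> 'M_(n, p)) :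
  (forall i j, polyfun (fun v => A v i j)) -> (forall i j, polyfun (fun v => B v i j)) ->
  forall i j, polyfun (fun v => (A v *m B v) i j).
Proof.
move=> pA pB i j; apply: (@eq_polyfun (fun v => \sum_k A v i k * B v k j)) => [v|].
  by rewrite mxE.
by apply: polyfun_sum => k; apply: polyfunM.
Qed.

Lemma polyfun_det n (A : (V -> K) -> 'M_n) :
  (forall i j, polyfun (fun v => A v i j)) -> polyfun (fun v => \det (A v)).
Proof.
move=> pA; apply: polyfun_sum => s.
by apply: polyfunM; [apply: polyfun_const | apply: polyfun_prod].
Qed.

(** The compressing matrices found at [v0] are kept constant; the open set is the nonvanishing locus
    of the resulting determinant. *)
Lemma general_rank m n r (A : (V -> K) -> 'M_(m, n)) v0 :
  (forall i j, polyfun (fun v => A v i j)) -> (r <= \rank (A v0))%N ->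
  general (fun v => (r <= \rank (A v))%N).
Proof.
move=> pA /rank_geP [U [W d0]].
have [G Gdet] : polyfun (fun v => \det (U *m A v *m W)).
  apply: polyfun_det; apply: polyfun_mulmx => [|i j]; last exact: polyfun_const.
  by apply: polyfun_mulmx => // i j; exact: polyfun_const.
exists G; split; first by exists v0; rewrite Gdet.
by move=> v; rewrite Gdet => dv; apply/rank_geP; exists U, W.
Qed.

End PolynomialFunctions.

Lemma polyfun_interp (K : fieldType) d x y z r c :
  polyfun (fun v : 'I_(x + y + z) * 'I_4 -> K =>
             @interp_mx K d x y z (fun j i => v (j, i)) r c).
Proof.
set jc : 'I_(x + y + z) * DerIdx d := enum_val c.
have [lt_m | ge_m] := boolP (\sum_(i < 4) (jc.2 i : nat) < mult x y jc.1)%N; last first.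
  apply: eq_polyfun (polyfun_const _ 0) => v.
  by rewrite mxE /= -/jc (negPf ge_m).
set b : Mon d := enum_val r.
apply: (@eq_polyfun _ _ (fun v => \prod_(i < 4) (((val b i : nat) ^_ (jc.2 i : nat))%:R
          * v (jc.1, i) ^+ ((val b i : nat) - jc.2 i)))) => [v|].
  by rewrite mxE /= -/jc lt_m.
apply: polyfun_prod => i; apply: polyfunM; first exact: polyfun_const.
exact/polyfunX/polyfun_var.
Qed.

(** * Dimension counts, and good postulation from maximal rank *)

Lemma card_Mon d : #|{: Mon d}| = 'C(d + 3, 3).
Proof.
rewrite card_sig addnC -card_ord_partitions.
pose f (t : 4.-tuple 'I_d.+1) : {ffun 'I_4 -> 'I_d.+1} := [ffun i => tnth t i].
pose g (e : {ffun 'I_4 -> 'I_d.+1}) : 4.-tuple 'I_d.+1 := [tuple e i | i < 4].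
have fg : bijective f.
  exists g => [t | e]; first by apply: eq_from_tnth => i; rewrite tnth_mktuple ffunE.
  by apply/ffunP => i; rewrite ffunE tnth_mktuple.
rewrite -(on_card_preimset (onW_bij _ fg)); apply: eq_card => t; rewrite !inE big_tuple.
by congr (_ == _); apply: eq_bigr => i _; rewrite ffunE.
Qed.

Lemma lengthYE x y z : lengthY x y z = (20 * x + 10 * y + 4 * z)%N.
Proof.
rewrite /lengthY -(big_mkord xpredT (fun j => 'C(mult x y j + 2, 3))).
rewrite (big_cat_nat _ (n := (x + y)%N)) ?leq_addr //= (big_cat_nat _ (n := x)) ?leq_addr //=.
rewrite (@eq_big_nat _ _ _ 0 x _ (fun=> 20%N)); last first.
  by move=> j /andP[_ jx]; rewrite /mult jx.
rewrite (@eq_big_nat _ _ _ x (x + y) _ (fun=> 10%N)); last first.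
  by move=> j /andP[xj jy]; rewrite /mult ltnNge xj jy.
rewrite (@eq_big_nat _ _ _ (x + y) (x + y + z) _ (fun=> 4%N)); last first.
  move=> j /andP[xyj _]; rewrite /mult ltnNge (leq_trans _ xyj) ?leq_addr //=.
  by rewrite ltnNge xyj.
by rewrite !sum_nat_const_nat subn0; lia.
Qed.

Lemma postulation_of_rank (K : fieldType) d x y z (P : 'I_(x + y + z) -> 'I_4 -> K) :
  (minn (20 * x + 10 * y + 4 * z) 'C(d + 3, 3) <= \rank (@interp_mx K d x y z P))%N ->
  ((20 * x + 10 * y + 4 * z <= 'C(d + 3, 3))%N -> @h1_IY K d x y z P = 0%N) /\
  ((20 * x + 10 * y + 4 * z >= 'C(d + 3, 3))%N -> @h0_IY K d x y z P = 0%N).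
Proof.
rewrite /h1_IY /h0_IY lengthYE => rk; split=> le; apply/eqP; rewrite subn_eq0;
  apply: leq_trans rk; first by rewrite (minn_idPl le).
by rewrite (minn_idPr le) card_Mon.
Qed.

(** * Degeneration *)

Definition partial_monomial (q a b : 'I_4 -> nat) : nat :=
  (\prod_(i < 4) (a i ^_ b i * q i ^ (a i - b i)))%N.

Definition weight (lam a : 'I_4 -> nat) : nat := (\sum_(i < 4) lam i * a i)%N.

(** The derivative of order [b] of the monomial [a] is homogeneous of multidegree [a - b]. The
    factor of weight [b] on the left avoids a negative power of [s]; if some [b i] exceeds [a i],
    both sides vanish through the falling factorial. *)
Lemma partial_monomial_scale (K : fieldType) (s : K) (q lam a b : 'I_4 -> nat) :
  s ^+ weight lam b *
    (\prod_(i < 4) ((a i ^_ b i)%:R * ((q i)%:R * s ^+ lam i) ^+ (a i - b i)))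
  = s ^+ weight lam a * (partial_monomial q a b)%:R.
Proof.
rewrite /weight !expr_sum /partial_monomial natr_prod -!big_split /=.
apply: eq_bigr => i _; have [le_ba | lt_ab] := leqP (b i) (a i); last first.
  by rewrite ffact_small // !mul0n !mul0r !mulr0.
rewrite exprMn natrM natrX -exprM.
have <- : s ^+ (lam i * b i) * s ^+ (lam i * (a i - b i)) = s ^+ (lam i * a i).
  by rewrite -exprD -mulnDr subnKC.
by rewrite -!mulrA; congr (_ * _); rewrite mulrA mulrC.
Qed.

Section Degeneration.
Variables (d x y z : nat) (lam Q : 'I_(x + y + z) -> 'I_4 -> nat) (w : Mon d -> nat).

Definition cond_order (jb : 'I_(x + y + z) * DerIdx d) : bool :=
  (\sum_(i < 4) (jb.2 i : nat) < mult x y jb.1)%N.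

Definition cond_value (a : Mon d) (jb : 'I_(x + y + z) * DerIdx d) : nat :=
  partial_monomial (Q jb.1) (fun i => val a i) (fun i => jb.2 i).

Definition cond_weight (a : Mon d) (jb : 'I_(x + y + z) * DerIdx d) : nat :=
  weight (lam jb.1) (fun i => val a i).

Definition limit_entry (a : Mon d) (jb : 'I_(x + y + z) * DerIdx d) : nat :=
  if cond_order jb && (cond_weight a jb == w a) then cond_value a jb else 0%N.

Definition limit_mx (F : fieldType) :
    'M[F]_(#|{: Mon d}|, #|{: 'I_(x + y + z) * DerIdx d}|) :=
  \matrix_(i, c) (limit_entry (enum_val i) (enum_val c))%:R.

(* At the points with coordinates [Q j i * s ^ lam j i], clearing a power of [s]
   from each row and each column leaves a matrix that is polynomial in [s]; its
   value at [s = 0] keeps only the entries where the weight is minimal. *)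
Lemma interp_degenerate (K : fieldType) p r :
  [pchar K] =i pred0 -> prime p -> (forall a jb, (w a <= cond_weight a jb)%N) ->
  (r <= \rank (limit_mx 'F_p))%N -> exists P, (r <= \rank (@interp_mx K d x y z P))%N.
Proof.
move=> K0 p_pr w_min le_r.
pose A : 'M[{poly K}]_(#|{: Mon d}|, #|{: 'I_(x + y + z) * DerIdx d}|) :=
  \matrix_(i, c) let a : Mon d := enum_val i in
    let jb : 'I_(x + y + z) * DerIdx d := enum_val c in
    if cond_order jb then (cond_value a jb)%:R *: 'X^(cond_weight a jb - w a) else 0.
have {le_r} le_r : (r <= \rank (map_mx (horner_eval 0) A))%N.
  suff -> : map_mx (horner_eval 0) A = limit_mx K.
    exact: leq_trans le_r (rank_natr_mod
      (fun i c => limit_entry (enum_val i) (enum_val c)) K0 p_pr).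
  apply/matrixP => i c; rewrite !mxE /limit_entry /= /horner_eval.
  case: (cond_order _); last by rewrite horner0.
  rewrite hornerZ hornerXn expr0n subn_eq0 eqn_leq w_min andbT.
  by case: (_ <= _)%N; rewrite ?mulr1 ?mulr0.
have [s s0 le_s] := rank_specialize A K0.
exists (fun j i => (Q j i)%:R * s ^+ lam j i).
apply: leq_trans le_r (leq_trans le_s _); set M := interp_mx _ _.
pose D1 : 'rV[K]_#|{: Mon d}| := \row_i s ^- w (enum_val i).
pose D2 : 'rV[K]_#|{: 'I_(x + y + z) * DerIdx d}| :=
  \row_c let jb : 'I_(x + y + z) * DerIdx d := enum_val c in
    s ^+ weight (lam jb.1) (fun i => jb.2 i).
suff -> : map_mx (horner_eval s) A = diag_mx D1 *m M *m diag_mx D2.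
  by apply: leq_trans (mxrankM_maxl _ _) _; apply: mxrankM_maxr.
apply/matrixP => i c; rewrite mul_mx_diag mul_diag_mx !mxE /= /horner_eval.
rewrite -/(cond_order _); case: ifP => _; last by rewrite horner0 mulr0 mul0r.
rewrite hornerZ hornerXn -[RHS]mulrA [in RHS](mulrC (\prod_(_ < _) _)).
rewrite partial_monomial_scale -/(cond_weight (enum_val i) (enum_val c)).
rewrite -/(cond_value _ _) mulrA [RHS]mulrC; congr (_ * _).
by rewrite mulrC expfB_cond // (negPf s0) add0n w_min.
Qed.

End Degeneration.

(** * Soundness of the elimination *)

Lemma nat_of_F31K : cancel nat_of_F31 (nth e0 F31_enum).
Proof. by case. Qed.

HB.instance Definition _ := Equality.copy F31 (can_type nat_of_F31K).

Definition Fp : fieldType := 'F_31.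

Definition toFp (x : F31) : Fp := (nat_of_F31 x)%:R.

Lemma F31_allP (P : pred F31) : reflect (forall x, P x) (all P F31_enum).
Proof.
apply: (iffP idP) => [allP | Px]; last by rewrite /= !Px.
by move=> x; rewrite -(nat_of_F31K x); apply: all_nthP allP _ _; case: x.
Qed.

(** Reduces the correctness of the addition and multiplication tables to a computation over all
    pairs. *)
Lemma F31_all2P (P : F31 -> F31 -> bool) :
  all (fun x => all (P x) F31_enum) F31_enum -> forall x y, P x y.
Proof. by move=> /F31_allP allP x y; apply/F31_allP. Qed.

Lemma natr_F31 (m : nat) : ((m %% 31)%:R : Fp) = m%:R.
Proof. exact: (@Fp_nat_mod 31 isT). Qed.

Lemma toFpD x y : toFp (F31_add x y) = toFp x + toFp y.
Proof.
rewrite /toFp -natrD -[RHS]natr_F31; congr _%:R; apply/eqP.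
by apply: (F31_all2P (P := fun x y =>
  nat_of_F31 (F31_add x y) == (nat_of_F31 x + nat_of_F31 y) %% 31)%N).
Qed.

Lemma toFpM x y : toFp (F31_mul x y) = toFp x * toFp y.
Proof.
rewrite /toFp -natrM -[RHS]natr_F31; congr _%:R; apply/eqP.
by apply: (F31_all2P (P := fun x y =>
  nat_of_F31 (F31_mul x y) == (nat_of_F31 x * nat_of_F31 y) %% 31)%N).
Qed.

Lemma toFp_of_nat m : toFp (F31_of_nat m) = m%:R.
Proof.
rewrite -[RHS]natr_F31 /toFp /F31_of_nat; congr _%:R.
have: (m %% 31 < 31)%N by rewrite ltn_mod.
by move: (m %% 31)%N; do 31![case => //].
Qed.

Lemma toFp_oppinv x : x <> e0 -> toFp (F31_oppinv x) * toFp x = -1.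
Proof.
move=> x0; apply/eqP; rewrite -addr_eq0 /toFp -natrM -[1]/(1%:R) -natrD addn1 -natr_F31.
by move: x0; case: x.
Qed.

Lemma toFp_eq0 x : toFp x = 0 -> x = e0.
Proof.
move/eqP; rewrite -(dvdn_pcharf (pchar_Fp (isT : prime 31))) => dvd_x.
by move: dvd_x; case: x.
Qed.

Definition dot (r : seq F31) (U : seq Fp) : Fp :=
  \sum_(p <- zip r U) toFp p.1 * p.2.

Lemma dot_cons x r u U : dot (x :: r) (u :: U) = toFp x * u + dot r U.
Proof. by rewrite /dot big_cons. Qed.

Lemma dot_cat r1 r2 U1 U2 : size r1 = size U1 ->
  dot (r1 ++ r2) (U1 ++ U2) = dot r1 U1 + dot r2 U2.
Proof. by move=> eq_sz; rewrite /dot zip_cat // big_cat. Qed.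

Lemma dot_axpy f p r U : size p = size r ->
  dot (axpy f p r) U = dot r U + toFp f * dot p U.
Proof.
elim: p r U => [|a p IHp] [|b r] [|u U] //= eq_sz.
- by rewrite /dot !big_nil mulr0 addr0.
- by rewrite /dot !big_nil mulr0 addr0.
- by rewrite /dot /= !big_nil mulr0 addr0.
by case: eq_sz => eq_sz; rewrite !dot_cons IHp // toFpD toFpM; ring.
Qed.

Lemma size_axpy f p r : size p = size r -> size (axpy f p r) = size r.
Proof. by elim: p r => [|a p IHp] [|b r] //= [/IHp ->]. Qed.

(** The pivot row determines [u] from [U], so clearing the other heads replaces the relations on
    [u :: U] by relations on [U] alone. The third conclusion is the back substitution: once [U] is
    orthogonal to everything, the nonzero pivot forces [u = 0]. *)
Lemma eliminate_sound n acc rows rows' u U :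
  eliminate acc rows = Some rows' ->
  all (fun r => size r == n) acc -> all (fun r => size r == n.+1) rows ->
  (forall r, r \in acc -> dot r U = 0) ->
  (forall r, r \in rows -> dot r (u :: U) = 0) ->
  [/\ all (fun r => size r == n) rows',
      forall r, r \in rows' -> dot r U = 0
    & (forall r, size r = n -> dot r U = 0) -> u = 0].
Proof.
elim: rows acc => [|[|x r] rows IH] acc //=.
have [-> | /eqP x0 E] := eqVneq x e0.
  move=> E acc_n /andP[/eqP[r_n] rows_n] accU rowsU; apply: IH E _ rows_n _ _.
  - by rewrite /= r_n eqxx.
  - move=> r'; rewrite inE => /predU1P[-> | /accU//].
    have := rowsU (e0 :: r); rewrite inE eqxx => /(_ isT).
    by rewrite dot_cons /toFp mul0r add0r.
  by move=> r' r'in; apply: rowsU; rewrite inE r'in orbT.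
(* The match on a nonzero head only reduces on a constructor, hence the case analysis over the 31
   values. *)
have {E} -> : rows' = catrev acc (map (clear_head (F31_oppinv x) r) rows).
  by case: x x0 E => x0; first [by case: x0 | by case=> <-].
move=> acc_n /andP[/eqP[r_n] rows_n] accU rowsU.
have rU : dot r U = - (toFp x * u).
  have := rowsU (x :: r); rewrite inE eqxx => /(_ isT).
  by rewrite dot_cons addrC => /eqP; rewrite addr_eq0 => /eqP.
have clear_n y r' : size (y :: r') = n.+1 ->
    size (clear_head (F31_oppinv x) r (y :: r')) = n /\
    dot (clear_head (F31_oppinv x) r (y :: r')) U = dot (y :: r') (u :: U).
  case=> r'_n; rewrite dot_cons.
  have [-> | /eqP y0] := eqVneq y e0.
    by rewrite /toFp mul0r add0r.
  have -> : clear_head (F31_oppinv x) r (y :: r') = axpy (F31_mul y (F31_oppinv x)) r r'.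
    by case: y y0 => y0; first [by case: y0 | by []].
  rewrite size_axpy ?dot_axpy ?r_n // toFpM rU; split=> //.
  have := toFp_oppinv x0; move: (toFp _) (toFp x) (toFp y) => a b c ab.
  by rewrite [RHS]addrC; congr (_ + _); rewrite -mulrA mulrN [a * _]mulrA ab; ring.
have {}clear_n r' : r' \in rows -> size (clear_head (F31_oppinv x) r r') = n /\
    dot (clear_head (F31_oppinv x) r r') U = 0.
  move=> r'in; have /eqP := allP rows_n _ r'in; have := rowsU r'.
  rewrite inE r'in orbT => /(_ isT); case: r' {r'in} => // y r' r'U /clear_n[-> ->].
  by split.
split=> [|r'|/(_ r r_n)].
- apply/allP => r'; rewrite catrevE mem_cat mem_rev => /orP[/(allP acc_n) // | /mapP[s sin ->]].
  by have [-> _] := clear_n _ sin.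
- by rewrite catrevE mem_cat mem_rev => /orP[/accU // | /mapP[s /clear_n[_ sU] ->]].
rewrite rU => /eqP; rewrite oppr_eq0 mulf_eq0 => /orP[/eqP/toFp_eq0 // | /eqP //].
Qed.

Lemma col_free_sound n rows U : col_free n rows ->
  all (fun r => size r == n) rows -> size U = n ->
  (forall r, r \in rows -> dot r U = 0) -> U = nseq n 0.
Proof.
elim: n rows U => [|n IHn] rows [|u U] //=.
case E: (eliminate [::] rows) => [rows'|] // free' rows_n [U_n] rowsU.
have [//|//|rows'_n rows'U u0] := eliminate_sound E _ rows_n _ rowsU.
have U0 := IHn _ _ free' rows'_n U_n rows'U.
rewrite U0 u0 // => r r_n; rewrite U0.
elim: n r r_n {IHn free' rows_n rows'_n U_n rows'U u0 U0 E rowsU} => [|n IHn] [|a r] //=.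
  by move=> _; rewrite /dot big_nil.
by case=> r_n; rewrite dot_cons mulr0 add0r IHn.
Qed.

Lemma dot_map (X : Type) (s : seq X) (g : X -> F31) (h : X -> Fp) :
  dot (map g s) (map h s) = \sum_(x <- s) toFp (g x) * h x.
Proof.
elim: s => [|x s IHs]; first by rewrite /dot !big_nil.
by rewrite /= dot_cons IHs big_cons.
Qed.

Lemma dot_flatten (X Y : Type) (xs : seq X) (D : X -> seq Y)
    (g : X -> Y -> F31) (h : X -> Y -> Fp) :
  dot (flatten [seq [seq g x b | b <- D x] | x <- xs])
      (flatten [seq [seq h x b | b <- D x] | x <- xs])
  = \sum_(x <- xs) \sum_(b <- D x) toFp (g x b) * h x b.
Proof.
elim: xs => [|x xs IHs]; first by rewrite /dot !big_nil.
by rewrite /= dot_cat ?size_map // IHs big_cons dot_map.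
Qed.

Lemma dot_mapr0 r n : dot r (nseq n 0) = 0.
Proof.
elim: n r => [|n IHn] [|a r]; rewrite ?dot_cons ?mulr0 ?add0r //; by rewrite /dot ?big_nil.
Qed.

Lemma dot_nth (X : Type) (x0 : X) (s : seq X) (g : X -> F31) U : size U = size s ->
  dot (map g s) U = \sum_(i < size s) toFp (g (nth x0 s i)) * U`_i.
Proof.
elim: s U => [|x s IHs] [|u U] // => [_|[sz]]; first by rewrite /dot big_nil big_ord0.
by rewrite /= dot_cons big_ord_recl IHs.
Qed.

Lemma transpose_map (X Y : Type) (f : X -> Y -> F31) (c : seq X) (s : seq Y) :
  transpose (size s) [seq [seq f a x | x <- s] | a <- c] = [seq [seq f a x | a <- c] | x <- s].
Proof. by elim: s => //= x s <-; rewrite -!map_comp. Qed.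

(** Rows are monomials of a cell and columns are conditions. [cols_free] says that the conditions
    are independent; [rows_free] says that no nonzero form supported on the cell satisfies all of
    them. *)
Definition cols_free (X Y : eqType) (f : X -> Y -> F31) (c : seq X) (s : seq Y) :=
  forall U, size U = size s -> (forall a, a \in c -> dot [seq f a x | x <- s] U = 0) ->
  U = nseq (size s) 0.

Definition rows_free (X Y : eqType) (f : X -> Y -> F31) (c : seq X) (s : seq Y) :=
  forall V, size V = size c -> (forall x, x \in s -> dot [seq f a x | a <- c] V = 0) ->
  V = nseq (size c) 0.

Lemma col_free_cols (X Y : eqType) (f : X -> Y -> F31) c s :
  col_free (size s) [seq [seq f a x | x <- s] | a <- c] -> cols_free f c s.
Proof.
move=> free U sz_U cU; apply: (col_free_sound free) => // [|r].
  by apply/allP => r /mapP[a _ ->]; rewrite size_map.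
by case/mapP => a /cU aU ->.
Qed.

Lemma col_free_rows (X Y : eqType) (f : X -> Y -> F31) c s :
  col_free (size c) (transpose (size s) [seq [seq f a x | x <- s] | a <- c]) ->
  rows_free f c s.
Proof. by rewrite transpose_map; exact: (@col_free_cols _ _ (fun x a => f a x)). Qed.

(** A square matrix with trivial kernel is invertible, and so is its transpose; a square block thus
    needs only one elimination for both properties. *)
Lemma cols_free_square (X Y : eqType) (f : X -> Y -> F31) c s :
  size c = size s -> cols_free f c s -> rows_free f c s.
Proof.
(* The nonempty case supplies the default elements for [nth]. *)
case: c s => [|a0 c0] [|x0 s0] //; first by move=> _ _ [].
move: (a0 :: c0) (x0 :: s0) => c s {c0 s0} sz free V sz_V sV.
pose M : 'M[Fp]_(size s) := \matrix_(i, j) toFp (f (nth a0 c i) (nth x0 s j)).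
have: row_free M^T.
  apply: inj_row_free => v vM; pose U := [seq v 0 i | i <- enum 'I_(size s)].
  have sz_U : size U = size s by rewrite size_map size_enum_ord.
  have U_nth (i : 'I_(size s)) : U`_i = v 0 i.
    by rewrite (nth_map i) ?size_enum_ord // nth_ord_enum.
  have /(congr1 (nth 0 ^~ _)) U0 : U = nseq (size s) 0.
    apply: free => // a a_in; rewrite (dot_nth x0) //.
    have i_lt : (index a c < (size s))%N by rewrite -sz index_mem.
    have /rowP/(_ (Ordinal i_lt)) := vM; rewrite !mxE; apply: etrans.
    by apply: eq_bigr => j _; rewrite !mxE /= nth_index // U_nth mulrC.
  by apply/rowP => i; rewrite -U_nth U0 nth_nseq ltn_ord mxE.
rewrite row_free_unit unitmx_tr -row_free_unit => /row_freeP[B MB].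
pose v : 'rV[Fp]_(size s) := \row_i V`_i.
have v0 : v = 0.
  rewrite -[v]mulmx1 -MB mulmxA; suff -> : v *m M = 0 by rewrite mul0mx.
  apply/rowP => j; rewrite !mxE; have := sV _ (mem_nth x0 (ltn_ord j)).
  rewrite (dot_nth a0) // sz; apply: etrans.
  by apply: eq_bigr => i _; rewrite !mxE mulrC.
apply: (@eq_from_nth _ 0); rewrite ?size_nseq // => i; rewrite sz_V => i_lt.
rewrite nth_nseq i_lt; rewrite sz in i_lt.
by have /rowP/(_ (Ordinal i_lt)) := v0; rewrite !mxE.
Qed.

(** * Table entries as derivatives of monomials, and exponent vectors as quadruples *)

Definition jet_entry (a : quad) (q : F31 * F31 * F31) (b : nat * nat * nat) : F31 :=
  let: (_, a1, a2, a3) := a in let: (q1, q2, q3) := q in let: (b1, b2, b3) := b in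
  F31_mul (nth e0 (nth [::] (power_ders q1) a1) b1)
    (F31_mul (nth e0 (nth [::] (power_ders q2) a2) b2)
             (nth e0 (nth [::] (power_ders q3) a3) b3)).

Lemma jetE m a q : jet m a q = [seq jet_entry a q b | b <- ders m].
Proof. by case: a q => [[[? ?] ?] ?] [[? ?] ?]. Qed.

(* A condition is a pair: the position of a point in [points], and a derivation. *)
Definition condition_entry (a : quad) (x : nat * (nat * nat * nat)) : F31 :=
  jet_entry a (point x.1) x.2.

Definition conditions (its : seq (nat * nat)) : seq (nat * (nat * nat * nat)) :=
  flatten [seq [seq (it.2, b) | b <- ders it.1] | it <- its].

Definition items (s : nat) (t : content) : seq (nat * nat) :=
  let: (a, b, c) := t in
  [seq (4, s + i) | i <- iota 0 a] ++ [seq (3, s + 6 + i) | i <- iota 0 b] ++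
  [seq (2, s + 16 + i) | i <- iota 0 c].

Lemma content_rowE s a t : let: (i, j, k) := t in (i <= 6)%N -> (j <= 10)%N -> (k <= 24)%N ->
  content_row t (jets s a) = [seq condition_entry a x | x <- conditions (items s t)].
Proof.
case: t => [[i j] k] i6 j10 k24.
rewrite /content_row /jets -!map_take !take_iota (minn_idPl i6) (minn_idPl j10) (minn_idPl k24).
rewrite /conditions /items map_flatten; congr flatten.
rewrite !map_cat -!map_comp; congr (_ ++ (_ ++ _));
  by apply: eq_map => l /=; rewrite jetE.
Qed.

Lemma size_conditions s t : size (conditions (items s t)) = content_length t.
Proof.
have sz m f n : size (conditions [seq (m, f i) | i <- iota 0 n]) = (size (ders m) * n)%N.
  rewrite /conditions size_flatten /shape -!map_comp sumnE big_map.
  under eq_bigr do rewrite /= size_map.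
  by rewrite big_const_seq count_predT size_iota iter_addn_0.
case: t => [[i j] k]; rewrite /conditions /items !map_cat !flatten_cat !size_cat.
by rewrite -!/(conditions _) !sz addnA.
Qed.

Lemma content_ok_sound s c t : content_ok (size c) (map (jets s) c) t ->
  ((content_length t <= size c)%N -> cols_free condition_entry c (conditions (items s t))) /\
  ((size c <= content_length t)%N -> rows_free condition_entry c (conditions (items s t))).
Proof.
rewrite /content_ok -map_comp; case E: t => [[i j] k].
case/and4P => i6 j10 k24; rewrite -E.
have -> : map (content_row t \o jets s) c =
    [seq [seq condition_entry a x | x <- conditions (items s t)] | a <- c].
  by apply: eq_map => a /=; rewrite E (@content_rowE s a (i, j, k)).
rewrite -(size_conditions s); case: leqP => [le_lc /col_free_cols free | lt_cl free].
  by split=> // le_cl; apply: cols_free_square => //; apply/eqP; rewrite eqn_leq le_cl.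
by split=> // _; exact: col_free_rows.
Qed.

Lemma toFp_exp q k : toFp (F31_exp q k) = (nat_of_F31 q ^ k)%:R.
Proof. by elim: k => // k IHk; rewrite /= toFpM IHk expnS natrM. Qed.

Lemma power_derP q a b :
  toFp (power_der q a b) = (a ^_ b * nat_of_F31 q ^ (a - b))%:R.
Proof.
elim: b a => [|b IHb] a; first by rewrite ffactn0 mul1n subn0 -toFp_exp; case: a.
case: a => [|a]; first by rewrite ffact_small.
rewrite -[power_der q a.+1 b.+1]/(F31_mul (F31_of_nat a.+1) (power_der q a b)).
by rewrite toFpM IHb toFp_of_nat -natrM ffactSS subSS mulnA.
Qed.

Lemma nth_power_ders q a b : (a < 14)%N -> (b < 4)%N ->
  nth e0 (nth [::] (power_ders q) a) b = power_der q a b.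
Proof.
have -> : power_ders q = [seq [seq power_der q a b | b <- iota 0 4] | a <- iota 0 14].
  by case: q; vm_compute.
move=> lt_a lt_b; rewrite (nth_map 0%N) ?size_iota // nth_iota //.
by rewrite (nth_map 0%N) ?size_iota // nth_iota.
Qed.

Definition coord (a : quad) (i : 'I_4) : nat :=
  let: (a0, a1, a2, a3) := a in nth 0%N [:: a0; a1; a2; a3] i.

Definition affine_quad (b : nat * nat * nat) : quad := (0%N, b.1.1, b.1.2, b.2).

Definition point_coord (pos : nat) : quad :=
  let: (q1, q2, q3) := point pos in (1%N, nat_of_F31 q1, nat_of_F31 q2, nat_of_F31 q3).

Lemma mem_ders m b : (2 <= m <= 4)%N ->
  (b \in ders m) = (b.1.1 + b.1.2 + b.2 < m)%N.
Proof.
case: b => [[b1 b2] b3]; case: m => [|[|[|[|[|m]]]]] // _;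
  case: b1 => [|[|[|[|b1]]]]; case: b2 => [|[|[|[|b2]]]];
  by case: b3 => [|[|[|[|b3]]]].
Qed.

Lemma uniq_ders m : uniq (ders m).
Proof. by rewrite take_uniq. Qed.

(** The point has [X_0 = 1] and the derivation has order 0 along [X_0], so the factor of [X_0] is 1
    and only the three tabulated factors remain. *)
Lemma condition_entryP (a : quad) pos b :
  (forall i, coord a i < 14)%N -> (b.1.1 + b.1.2 + b.2 < 4)%N ->
  toFp (condition_entry a (pos, b)) =
  (partial_monomial (coord (point_coord pos)) (coord a) (coord (affine_quad b)))%:R.
Proof.
case: a b => [[[a0 a1] a2] a3] [[b1 b2] b3] /= lt_a lt_b.
have lt1 := lt_a (@Ordinal 4 1 isT); have lt2 := lt_a (@Ordinal 4 2 isT).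
have lt3 := lt_a (@Ordinal 4 3 isT); rewrite /= in lt1 lt2 lt3.
rewrite /condition_entry /point_coord /=; case: (point pos) => [[q1 q2] q3] /=.
rewrite !toFpM !nth_power_ders //; try lia.
rewrite !power_derP -!natrM; congr _%:R.
by rewrite /partial_monomial !big_ord_recl big_ord0 /= ffactn0 exp1n !mul1n muln1.
Qed.

Section Exponents.
Variable d : nat.
Implicit Type e : {ffun 'I_4 -> 'I_d.+1}.

Definition quad_of e : quad :=
  (e ord0 : nat, e (@Ordinal 4 1 isT) : nat, e (@Ordinal 4 2 isT) : nat,
   e (@Ordinal 4 3 isT) : nat).

Lemma coord_quad_of e i : coord (quad_of e) i = e i.
Proof.
rewrite /coord /quad_of; case: i => [[|[|[|[|]]]] //= lt_i]; congr (e _ : nat); exact: val_inj.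
Qed.

Lemma quad_of_inj : injective quad_of.
Proof. by move=> e e' eq; apply/ffunP => i; apply: val_inj; rewrite /= -!coord_quad_of eq. Qed.

Lemma quad_of_sum e : (\sum_(i < 4) e i)%N =
  let: (a0, a1, a2, a3) := quad_of e in (a0 + a1 + a2 + a3)%N.
Proof.
rewrite !big_ord_recl big_ord0 /= addn0 !addnA.
by congr (_ + _ + _ + _)%N; congr (e _ : nat); apply: val_inj.
Qed.

Lemma quad_of_onto (a : quad) : (forall i, coord a i <= d)%N -> exists e, quad_of e = a.
Proof.
move=> le_d; exists [ffun i => inord (coord a i)].
rewrite /quad_of !ffunE !inordK ?ltnS //.
by case: a {le_d} => [[[? ?] ?] ?].
Qed.

End Exponents.

(** Transfers sums over the finite types of exponent vectors to sums over the explicit lists on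
    which the computation runs. *)
Lemma big_injective (R : nmodType) (T : finType) (Y : eqType) (P : pred T) (q : T -> Y)
    (s : seq Y) (f : Y -> R) :
  injective q -> uniq s -> (forall t, P t -> q t \in s) ->
  (forall y, y \in s -> exists2 t, P t & q t = y) ->
  \sum_(t | P t) f (q t) = \sum_(y <- s) f y.
Proof.
move=> q_inj s_uniq sub sup.
rewrite [RHS](perm_big [seq q t | t <- enum P]) /=.
  by rewrite big_map big_enum; apply: eq_bigl.
rewrite perm_sym; apply: uniq_perm; rewrite ?map_inj_uniq ?enum_uniq // => y.
apply/mapP/idP => [[t] | /sup[t Pt <-]]; first by rewrite mem_enum => Pt ->; apply: sub.
by exists t; rewrite // mem_enum.
Qed.

Lemma mem_monomials d (a : quad) :
  (a \in monomials d) = (let: (a0, a1, a2, a3) := a in a0 + a1 + a2 + a3 == d)%N.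
Proof.
apply/allpairsPdep/idP => [[[i j] [k []]] | ].
  case/allpairsPdep => [i' [j' []]]; rewrite !mem_iota => Hi Hj -> /= Hk ->; lia.
case: a => [[[a0 a1] a2] a3] /eqP sum_a; exists (a1, a2), a3; split.
- by apply/allpairsPdep; exists a1, a2; rewrite !mem_iota; split=> //; lia.
- by rewrite mem_iota /=; lia.
by congr (_, _, _, _); rewrite /=; lia.
Qed.

Lemma uniq_monomials d : uniq (monomials d).
Proof.
apply: allpairs_uniq_dep => [|ab _|[[a b] c] [[a' b'] c'] _ _ /=].
- apply: allpairs_uniq_dep => [|a _|[a b] [a' b'] _ _ /= [-> ->] //]; exact: iota_uniq.
- exact: iota_uniq.
by case=> _ -> -> ->.
Qed.

(** * The limit matrix *)

Definition weight0 : N * N * N * N := (0, 0, 0, 0)%num.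

Definition coordN (l : N * N * N * N) (i : 'I_4) : nat :=
  let: (l0, l1, l2, l3) := l in
  nth 0%N [:: N.to_nat l0; N.to_nat l1; N.to_nat l2; N.to_nat l3] i.

Lemma weightNE l a : N.to_nat (weightN l a) = weight (coordN l) (coord a).
Proof.
case: l a => [[[l0 l1] l2] l3] [[[a0 a1] a2] a3].
rewrite /weight !big_ord_recl big_ord0 /= addn0 /weightN.
by rewrite !N2Nat.inj_add !N2Nat.inj_mul !Nat2N.id !plusE !multE !addnA.
Qed.

Lemma min_weight_le ls k a : (k < size ls)%N ->
  (N.to_nat (min_weight ls a) <= N.to_nat (weightN (nth weight0 ls k) a))%N.
Proof.
rewrite /min_weight => lt_k; set ws := map _ _.
have lt_kw : (k < size ws)%N by rewrite size_map.
rewrite -(nth_map weight0 0%num (fun l => weightN l a)) // -/ws.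
move: (head _ ws) => w0; elim: ws k lt_kw {lt_k} => // w ws IH [|k] /= lt_k.
  by apply/leP; have := N.le_min_l w (foldr N.min w0 ws); lia.
apply: leq_trans (IH k lt_k); apply/leP.
by have := N.le_min_r w (foldr N.min w0 ws); lia.
Qed.

(** An owner below [size ls] is not the junk value, so the list of indices attaining the minimum is
    a singleton. *)
Lemma owner_weight ls k a : (k < size ls)%N -> (owner ls a < size ls)%N ->
  (N.to_nat (weightN (nth weight0 ls k) a) == N.to_nat (min_weight ls a)) = (owner ls a == k).
Proof.
move=> lt_k; rewrite /owner /min_weight.
rewrite -(nth_map weight0 0%num (fun l => weightN l a)) //.
set ws := map _ _; set w := foldr _ _ _.
have sz_ws : size ws = size ls by rewrite size_map.
rewrite -{1}sz_ws; set ks := [seq _ <- _ | _].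
have mem_k : (k \in ks) = (N.to_nat (nth 0%num ws k) == N.to_nat w).
  rewrite mem_filter mem_iota sz_ws lt_k !andbT.
  by apply/idP/eqP => [/N.eqb_eq -> // | /N2Nat.inj /N.eqb_eq].
rewrite -mem_k; case: ks {mem_k} => [|k' [|? ?]]; rewrite ?ltnn //.
by rewrite inE eq_sym.
Qed.

Lemma cellE ls d k : cell (owners ls d) k = [seq a <- monomials d | owner ls a == k].
Proof. by rewrite /cell /owners filter_map -map_comp map_id. Qed.

Section Limit.
(** A triple in [ps] stands for a point of the scheme: its multiplicity, its cell and its position
    in [points]. *)
Variables (d x y z : nat) (ls : seq (N * N * N * N)) (ps : seq (nat * nat * nat)).
Hypotheses (d3 : (3 <= d)%N) (d13 : (d <= 13)%N).
Hypothesis owned : forall a, a \in monomials d -> (owner ls a < size ls)%N.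
Hypothesis ps_mult : [seq t.1.1 | t <- ps] = nseq x 4 ++ nseq y 3 ++ nseq z 2.
Hypothesis ps_cell : forall t, t \in ps -> (t.1.2 < size ls)%N.

Let item (j : 'I_(x + y + z)) := nth (0, 0, 0)%N ps j.
Let lam (j : 'I_(x + y + z)) := coordN (nth weight0 ls (item j).1.2).
Let Q (j : 'I_(x + y + z)) := coord (point_coord (item j).2).
Let mq (a : Mon d) : quad := quad_of (val a).
Let w (a : Mon d) := N.to_nat (min_weight ls (mq a)).
Let its k := [seq (t.1.1, t.2) | t <- ps & t.1.2 == k].

Let sz_ps : size ps = (x + y + z)%N.
Proof. by have := congr1 size ps_mult; rewrite size_map !size_cat !size_nseq addnA. Qed.

Let item_in j : item j \in ps.
Proof. by rewrite mem_nth // sz_ps. Qed.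

Let item_mult j : (item j).1.1 = mult x y j.
Proof.
rewrite /item -(nth_map _ 0%N (fun t => t.1.1)) ?sz_ps // ps_mult /mult.
rewrite !nth_cat !nth_nseq !size_nseq; case: ltnP => // le_xj.
have -> : (j - x < y)%N = (j < x + y)%N by lia.
by case: ltnP => // le_xyj; case: ltnP => //; have := ltn_ord j; lia.
Qed.

Let item_onto t : t \in ps -> exists j, item j = t.
Proof.
move=> t_in; have lt_i : (index t ps < x + y + z)%N by rewrite -sz_ps index_mem.
by exists (Ordinal lt_i); rewrite /item /= nth_index.
Qed.

Let mq_in a : mq a \in monomials d.
Proof. by rewrite mem_monomials; have /eqP := valP a; rewrite quad_of_sum => /eqP. Qed.

Let mq_inj : injective mq.
Proof. by move=> a a' /quad_of_inj /val_inj. Qed.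

Let mq_onto q : q \in monomials d -> exists a, mq a = q.
Proof.
move=> q_in; have [i|e eq] := @quad_of_onto d q.
  move: q_in; rewrite mem_monomials; case: q => [[[q0 q1] q2] q3] /eqP.
  by case: i => [[|[|[|[|]]]] //= _]; lia.
have e_sum : (\sum_(i < 4) (e i : nat) == d)%N.
  by rewrite quad_of_sum eq; move: q_in; rewrite mem_monomials; case: q eq => [[[]]].
by exists (exist _ e e_sum).
Qed.

Lemma limit_weight_min a jb : (w a <= cond_weight lam a jb)%N.
Proof.
rewrite /cond_weight /lam.
have -> : weight (coordN (nth weight0 ls (item jb.1).1.2)) (fun i => val a i) =
          N.to_nat (weightN (nth weight0 ls (item jb.1).1.2) (mq a)).
  by rewrite weightNE; apply: eq_bigr => i _; rewrite coord_quad_of.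
by apply: min_weight_le; apply/ps_cell/item_in.
Qed.

Let entry a (j : 'I_(x + y + z)) b := toFp (condition_entry (mq a) ((item j).2, b)).

(** This is the block diagonal shape of the limit matrix: by uniqueness of the minimum, a point sees
    only the monomials of its own cell. *)
Lemma limit_entryE a (j : 'I_(x + y + z)) (e : DerIdx d) b : quad_of e = affine_quad b ->
  (b.1.1 + b.1.2 + b.2 < mult x y j)%N ->
  (limit_entry lam Q w a (j, e))%:R =
  if owner ls (mq a) == (item j).1.2 then entry a j b else 0.
Proof.
move=> eb lt_b; rewrite /limit_entry.
have -> : cond_order (j, e).
  by rewrite /cond_order /= quad_of_sum eb /= add0n.
have -> : cond_weight lam a (j, e) = N.to_nat (weightN (nth weight0 ls (item j).1.2) (mq a)).
  by rewrite weightNE; apply: eq_bigr => i _; rewrite coord_quad_of.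
rewrite owner_weight ?owned //; last exact/ps_cell/item_in.
rewrite andTb; case: ifP => // _; rewrite /entry condition_entryP.
- rewrite -eb; have <- // : cond_value Q a (j, e) =
    partial_monomial (coord (point_coord (item j).2)) (coord (mq a)) (coord (quad_of e)).
  by apply: eq_bigr => i _; rewrite (coord_quad_of e) (coord_quad_of (val a)).
- by move=> i; rewrite coord_quad_of (leq_trans (ltn_ord _)).
by apply: leq_trans lt_b _; rewrite /mult; do 2?case: ifP.
Qed.

Let mult_ders j b : (b \in ders (mult x y j)) = (b.1.1 + b.1.2 + b.2 < mult x y j)%N.
Proof. by apply: mem_ders; rewrite /mult; do 2?case: ifP. Qed.

Let derivation_onto (j : 'I_(x + y + z)) b : (b.1.1 + b.1.2 + b.2 < mult x y j)%N ->
  exists e : DerIdx d, quad_of e = affine_quad b.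
Proof.
move=> lt_b; apply: quad_of_onto => i; have: (mult x y j <= 4)%N by rewrite /mult; do 2?case: ifP.
by case: i => [[|[|[|[|]]]] //= _]; lia.
Qed.

(** A vector in the left kernel restricts on each cell to a vector in the left kernel of that block,
    which is zero. The columns of derivations without [X_0] suffice for this. *)
Lemma limit_rank_rows :
  (forall k, (k < size ls)%N ->
     rows_free condition_entry (cell (owners ls d) k) (conditions (its k))) ->
  (#|{: Mon d}| <= \rank (limit_mx lam Q w Fp))%N.
Proof.
move=> free.
apply: (rank_ge_rows (A := fun a jb => (limit_entry lam Q w a jb)%:R : Fp)) => u uA a.
pose v q := \sum_(a' | mq a' == q) u a'.
have v_mq a' : v (mq a') = u a'.
  by rewrite /v (big_pred1 a') // => a''; rewrite (inj_eq mq_inj).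
set k := owner ls (mq a).
have lt_k : (k < size ls)%N by apply: owned.
have := free k lt_k [seq v q | q <- cell (owners ls d) k]; rewrite size_map.
move=> /(_ erefl) V0; rewrite -v_mq.
have: v (mq a) \in [seq v q | q <- cell (owners ls d) k].
  by apply: map_f; rewrite cellE mem_filter mq_in eqxx.
rewrite {}V0 => [|[pos b]]; first by rewrite mem_nseq => /andP[_ /eqP].
case/flattenP => bs /mapP[it it_in ->] /mapP[b' b_in [-> ->]].
case/mapP: it_in b_in => t; rewrite mem_filter => /andP[/eqP t_k t_in] -> /= b_in.
have [j jt] := item_onto t_in.
have lt_b : (b'.1.1 + b'.1.2 + b'.2 < mult x y j)%N by rewrite -mult_ders -item_mult jt.
have [e eb] := derivation_onto lt_b.
have := uA (j, e); apply: etrans.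
rewrite dot_map cellE big_filter big_mkcond /=.
rewrite -(big_injective (P := xpredT) _ mq_inj (uniq_monomials d)) // => [|q /mq_onto[a' <-]].
  apply: eq_bigr => a' _; rewrite (limit_entryE _ eb lt_b) jt t_k v_mq /entry jt.
  by case: ifP => _; rewrite ?mulr0 // mulrC.
by exists a'.
Qed.

(* By Euler's formula the derivations along [X_0] give no new conditions; the columns
   of the others are as many as the length of the scheme. *)
Definition affine_conditions : {pred 'I_(x + y + z) * DerIdx d} :=
  fun jb => (jb.2 ord0 == 0%N :> nat) && cond_order (x := x) (y := y) (z := z) jb.

Lemma affine_sum (R : nmodType) (j : 'I_(x + y + z)) (f : quad -> R) :
  \sum_(e : DerIdx d | affine_conditions (j, e)) f (quad_of e) =
  \sum_(b <- ders (mult x y j)) f (affine_quad b).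
Proof.
rewrite -(big_map affine_quad xpredT); apply: big_injective; first exact: quad_of_inj.
- rewrite map_inj_uniq ?uniq_ders // => [[[b1 b2] b3] [[b1' b2'] b3']].
  by case=> -> -> ->.
- move=> e /andP[/= /eqP e0]; rewrite /cond_order /= quad_of_sum /quad_of /= e0 => lt_e.
  apply/mapP; exists (e (@Ordinal 4 1 isT) : nat, e (@Ordinal 4 2 isT) : nat,
    e (@Ordinal 4 3 isT) : nat) => //; by rewrite mult_ders.
move=> _ /mapP[b b_in ->]; rewrite mult_ders in b_in.
have [e eb] := derivation_onto b_in; exists e => //.
rewrite /affine_conditions /= /cond_order /= quad_of_sum eb /= add0n b_in andbT.
by have /(congr1 (fun q : quad => q.1.1.1)) /= -> := eb.
Qed.

Lemma card_affine_conditions : #|affine_conditions| = lengthY x y z.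
Proof.
rewrite -sum1_card (eq_bigl (fun jb => xpredT jb.1 && affine_conditions (jb.1, jb.2)));
  last by case.
rewrite -(pair_big_dep xpredT (fun j e => affine_conditions (j, e)) (fun _ _ => 1%N)) /=.
apply: eq_bigr => j _; rewrite (affine_sum j (fun=> 1%N : nat)) sum1_size.
by rewrite /mult; do 2?case: ifP.
Qed.

(** Read on the monomials of one cell, a relation between the affine columns involves only the
    points of that cell, so it is trivial block by block. *)
Lemma limit_rank_cols :
  (forall k, (k < size ls)%N ->
     cols_free condition_entry (cell (owners ls d) k) (conditions (its k))) ->
  (lengthY x y z <= \rank (limit_mx lam Q w Fp))%N.
Proof.
move=> free; rewrite -card_affine_conditions.
apply: (rank_ge_cols (A := fun a jb => (limit_entry lam Q w a jb)%:R : Fp)) => u uA [j0 f0] jf0.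
pose v j b := \sum_(e : DerIdx d | quad_of e == affine_quad b) u (j, e).
have vE j (e : DerIdx d) b : quad_of e = affine_quad b -> v j b = u (j, e).
  by move=> eb; rewrite /v (big_pred1 e) // => e'; rewrite -eb (inj_eq (@quad_of_inj d)).
set k := (item j0).1.2.
have lt_k : (k < size ls)%N by exact/ps_cell/item_in.
pose xs := [seq j <- enum 'I_(x + y + z) | (item j).1.2 == k].
have itsE : conditions (its k) =
    flatten [seq [seq ((item j).2, b) | b <- ders (item j).1.1] | j <- xs].
  have ps_enum : ps = [seq item j | j <- enum 'I_(x + y + z)].
    apply: (@eq_from_nth _ (0, 0, 0)%N) => [|i]; first by rewrite size_map size_enum_ord.
    rewrite sz_ps => lt_i; rewrite (nth_map (Ordinal lt_i)) ?size_enum_ord //.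
    by rewrite /item nth_enum_ord.
  by rewrite /conditions /its [in LHS]ps_enum filter_map -!map_comp.
pose U := flatten [seq [seq v j b | b <- ders (item j).1.1] | j <- xs].
have U0 : U = nseq (size (conditions (its k))) 0.
  apply: free lt_k _ _ _.
    rewrite itsE !size_flatten /shape -!map_comp; congr sumn.
    by apply: eq_map => j; rewrite /= !size_map.
  move=> q; rewrite cellE mem_filter => /andP[/eqP q_k /mq_onto[a aq]].
  rewrite itsE map_flatten -map_comp.
  have -> : [seq (map (condition_entry q) \o
        (fun j => [seq ((item j).2, b) | b <- ders (item j).1.1])) j | j <- xs] =
      [seq [seq condition_entry q ((item j).2, b) | b <- ders (item j).1.1] | j <- xs].
    by apply: eq_map => j; rewrite /= -map_comp.
  rewrite dot_flatten big_filter big_mkcond big_enum /=.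
  have := uA a; apply: etrans; apply: esym.
  (* Splits the relation into a sum over points and, for each, a sum over derivations; points of
     other cells contribute zero. *)
  rewrite (eq_big (fun p => xpredT p.1 && affine_conditions (p.1, p.2))
    (fun p => (limit_entry lam Q w a (p.1, p.2))%:R * u (p.1, p.2))); try by case.
  rewrite -(pair_big_dep xpredT (fun j e => affine_conditions (j, e))
    (fun j e => (limit_entry lam Q w a (j, e))%:R * u (j, e))) /=.
  apply: eq_bigr => j _.
  (* [trip] forgets the order along [X_0], which is 0 here; the summand becomes a function of
     [quad_of e], as [affine_sum] requires. *)
  pose trip (q : quad) := (q.1.1.2, q.1.2, q.2).
  pose f q := (if owner ls (mq a) == (item j).1.2 then entry a j (trip q) else 0) * v j (trip q).
  rewrite (eq_bigr (fun e => f (quad_of e))) => [|e /andP[/= /eqP e0 lt_e]].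
    rewrite affine_sum /f aq q_k eq_sym item_mult; case: ifP => [_|_]; last first.
      by rewrite big1 // => b _; rewrite mul0r.
    by apply: eq_bigr => -[[b1 b2] b3] _; rewrite /entry aq.
  have eb : quad_of e = affine_quad (trip (quad_of e)) by rewrite {1}/quad_of e0.
  rewrite /f (limit_entryE _ eb) ?(vE j _ _ eb) //.
  by move: lt_e; rewrite /cond_order /= quad_of_sum eb.
have /andP[/= /eqP e0 lt_e] := jf0.
pose b0 : nat * nat * nat := (f0 (@Ordinal 4 1 isT) : nat, f0 (@Ordinal 4 2 isT) : nat,
  f0 (@Ordinal 4 3 isT) : nat).
have eb0 : quad_of f0 = affine_quad b0 by rewrite /quad_of e0.
have : v j0 b0 \in U.
  apply/flattenP; exists [seq v j0 b | b <- ders (item j0).1.1].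
    by apply/mapP; exists j0; rewrite // mem_filter eqxx mem_enum.
  apply: map_f; rewrite item_mult mult_ders.
  by move: lt_e; rewrite /cond_order /= quad_of_sum eb0.
by rewrite (vE _ _ _ eb0) U0 mem_nseq => /andP[_ /eqP].
Qed.
End Limit.

(** * Distributing the points over the cells *)

(** A relation between the first columns extends by zeros. It serves to remove 2-points, which come
    last in [items]. *)
Lemma cols_free_prefix (X Y : eqType) (f : X -> Y -> F31) c s1 s2 :
  cols_free f c (s1 ++ s2) -> cols_free f c s1.
Proof.
move=> free U sz_U cU; have := free (U ++ nseq (size s2) 0).
rewrite !size_cat size_nseq sz_U nseqD => /(_ erefl) H.
have /eqP : U ++ nseq (size s2) 0 = nseq (size s1) 0 ++ nseq (size s2) 0.
  apply: H => a /cU aU; rewrite map_cat dot_cat ?size_map // aU add0r.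
  exact: dot_mapr0.
by rewrite eqseq_cat ?size_nseq // => /andP[/eqP].
Qed.

Lemma rows_free_sub (X Y : eqType) (f : X -> Y -> F31) c s1 s2 :
  {subset s1 <= s2} -> rows_free f c s1 -> rows_free f c s2.
Proof. by move=> sub free V sz_V sV; apply: free => // x /sub; apply: sV. Qed.

Lemma items_prefix s a b c c' : (c' <= c)%N ->
  exists its, items s (a, b, c) = items s (a, b, c') ++ its.
Proof.
move=> le_c; exists [seq (2, s + 16 + i)%N | i <- iota c' (c - c')].
rewrite /items; have -> : iota 0 c = iota 0 c' ++ iota c' (c - c').
  by rewrite -{1}(subnKC le_c) iotaD.
by rewrite map_cat -!catA.
Qed.

Lemma items_sub s a b c a' b' c' : (a' <= a)%N -> (b' <= b)%N -> (c' <= c)%N ->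
  {subset conditions (items s (a', b', c')) <= conditions (items s (a, b, c))}.
Proof.
move=> le_a le_b le_c x /flattenP[bs /mapP[it it_in ->] x_in].
apply/flattenP; eexists; last exact: x_in.
apply/mapP; exists it => //; move: it_in; rewrite !mem_cat.
have sub n n' (g : nat -> nat * nat) : (n' <= n)%N ->
    it \in [seq g i | i <- iota 0 n'] -> it \in [seq g i | i <- iota 0 n].
  move=> le_n /mapP[i]; rewrite mem_iota => i_lt ->; apply: map_f.
  by rewrite mem_iota; lia.
by case/or3P => /sub H; apply/or3P; [apply: Or31 | apply: Or32 | apply: Or33]; apply: H.
Qed.

Definition block (m K : nat) (h : nat -> nat -> nat) (cnt : nat -> nat) : seq (nat * nat * nat) :=
  flatten [seq [seq (m, k, h k i) | i <- iota 0 (cnt k)] | k <- iota 0 K].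

Lemma block_mult m K h cnt :
  [seq t.1.1 | t <- block m K h cnt] = nseq (\sum_(k < K) cnt k) m.
Proof.
rewrite /block -(big_mkord xpredT cnt) /index_iota subn0.
elim: (iota 0 K) => [|k ks IH]; first by rewrite big_nil.
rewrite /= map_cat IH big_cons nseqD; congr (_ ++ _).
by rewrite -map_comp -[X in nseq X](size_iota 0); elim: (iota 0 (cnt k)) => //= i s ->.
Qed.

Lemma block_cell m K h cnt t : t \in block m K h cnt -> (t.1.2 < K)%N.
Proof.
by case/flattenP => bs /mapP[k]; rewrite mem_iota => /andP[_ lt_k] -> /mapP[i _ ->].
Qed.

Lemma block_filter m K h cnt k : (k < K)%N ->
  [seq (t.1.1, t.2) | t <- block m K h cnt & t.1.2 == k] = [seq (m, h k i) | i <- iota 0 (cnt k)].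
Proof.
move=> lt_k; have: k \in iota 0 K by rewrite mem_iota.
have := iota_uniq 0 K; rewrite /block; elim: (iota 0 K) => // k' ks IH /= /andP[k'_nin ks_uniq].
have filt k2 : [seq (t.1.1, t.2) | t <- [seq (m, k2, h k2 i) | i <- iota 0 (cnt k2)] & t.1.2 == k]
    = if k2 == k then [seq (m, h k i) | i <- iota 0 (cnt k)] else [::].
  rewrite filter_map -map_comp; case: eqP => [-> | ne].
    by rewrite (@eq_filter _ _ predT) ?filter_predT // => i /=; rewrite eqxx.
  by rewrite (@eq_filter _ _ pred0) ?filter_pred0 // => i /=; apply/eqP.
rewrite filter_cat map_cat filt inE eq_sym; case: eqP => [<- _ | _ /= k_in]; last exact: IH.
suff -> : [seq t <- flatten [seq [seq (m, k2, h k2 i) | i <- iota 0 (cnt k2)] | k2 <- ks]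
            | t.1.2 == k'] = [::] by rewrite cats0.
apply/eqP; rewrite -(negbK (_ == _)) -has_filter; apply/hasPn => t.
by case/flattenP => bs /mapP[k2 k2_in ->] /mapP[i _ ->] /=; apply: contraNneq k'_nin => <-.
Qed.

(** The points are ordered by multiplicity first, as in [mult], and only then by cell; the shifts 0,
    6 and 16 are those of [jets]. *)
Definition place (K : nat) (ss : seq nat) (na nb nc : nat -> nat) :=
  block 4 K (fun k i => nth 0%N ss k + i)%N na ++
  block 3 K (fun k i => nth 0%N ss k + 6 + i)%N nb ++
  block 2 K (fun k i => nth 0%N ss k + 16 + i)%N nc.

Lemma place_filter K ss na nb nc k : (k < K)%N ->
  [seq (t.1.1, t.2) | t <- place K ss na nb nc & t.1.2 == k] =
  items (nth 0%N ss k) (na k, nb k, nc k).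
Proof. by move=> lt_k; rewrite !filter_cat !map_cat !block_filter. Qed.

(* 17 = 20 - 3: the last cell has at least 20 monomials, and at most 3 conditions are
   missing.  A cell that is not filled by 4-points and pairs of 3-points leaves at most
   one 3-point over, of length 10 <= 17, so that enough 2-points remain. *)
Lemma fill_cell m x y z : (20 * m + 17 <= 20 * x + 10 * y + 4 * z)%N ->
  exists i j, [/\ (i + j <= m)%N, (i <= x)%N, (2 * j <= y)%N & (5 * (m - (i + j)) <= z)%N].
Proof.
by move=> le; exists (minn x m), (minn (y %/ 2) (m - minn x m)); split; lia.
Qed.

(** Each cell consumes length exactly [20 * m], so the slack 17 is passed on to the remaining cells;
    [a], [b], [c] count the points left for the last cell. *)
Lemma fill_cells ms x y z : (20 * sumn ms + 17 <= 20 * x + 10 * y + 4 * z)%N ->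
  exists cs : seq content, exists a b c,
    [/\ size cs = size ms,
        forall k, (k < size ms)%N -> nth (0, 0, 0)%N cs k \in pure_contents (nth 0%N ms k),
        x = (sumn [seq t.1.1 | t <- cs] + a)%N,
        y = (sumn [seq t.1.2 | t <- cs] + b)%N
      & z = (sumn [seq t.2 | t <- cs] + c)%N /\
        (20 * sumn ms + (20 * a + 10 * b + 4 * c) = 20 * x + 10 * y + 4 * z)%N].
Proof.
elim: ms x y z => [|m ms IH] x y z le; first by exists [::], x, y, z; split.
have [|i [j [le_m le_x le_y le_z]]] := @fill_cell m x y z; first by move: le; rewrite /=; lia.
set l := (5 * (m - (i + j)))%N in le_z.
have [|cs [a [b [c [sz pure xE yE [zE lenE]]]]]] := IH (x - i)%N (y - 2 * j)%N (z - l)%N.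
  by move: le; rewrite /= /l; lia.
exists ((i, 2 * j, l)%N :: cs), a, b, c; split; rewrite /= ?sz //; try lia.
case=> [_|k] /=; last by rewrite ltnS; apply: pure.
apply/flattenP; exists [seq (i, 2 * j, 5 * (m - (i + j)))%N | j <- iota 0 (m - i).+1].
  by apply/mapP; exists i; rewrite // mem_iota; lia.
by apply/mapP; exists j; rewrite // mem_iota; lia.
Qed.

(** Chooses greedily how many 2-points each cell keeps when the auxiliary ones are taken away. *)
Lemma trim (s : seq nat) z : (z <= sumn s)%N ->
  exists s', [/\ size s' = size s, forall k, (nth 0 s' k <= nth 0 s k)%N & sumn s' = z].
Proof.
elim: s z => [|n s IH] z /= le_z; first by exists [::]; split=> //=; lia.
have [|s' [sz le_s sumE]] := IH (z - minn z n)%N; first by lia.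
exists (minn z n :: s'); split; rewrite /= ?sz ?sumE //; last by lia.
by case=> [|k] //=; exact: geq_minr.
Qed.

(** A tight content exceeds [r] by less than one point of each kind that occurs in it, so each count
    is at most one more than the quotient of [r] by the length of such a point. *)
Lemma tight_mem r t : tight r t -> t \in mixed_contents r.
Proof.
case: t => [[a b] c] t_ok; rewrite mem_filter t_ok andTb.
move: t_ok; rewrite /tight /content_length => t_ok.
apply/flattenP; exists (flatten [seq [seq (a, b', c') | c' <- iota 0 (r %/ 4).+2]
                                | b' <- iota 0 (r %/ 10).+2]).
  by apply/mapP; exists a; rewrite // mem_iota; lia.
apply/flattenP; exists [seq (a, b, c') | c' <- iota 0 (r %/ 4).+2].
  by apply/mapP; exists b; rewrite // mem_iota; lia.
by apply/mapP; exists c; rewrite // mem_iota; lia.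
Qed.

(** Remove points as long as the length stays at least [r]; the process stops exactly at a tight
    content. *)
Lemma tight_below r (t : content) : (r <= content_length t)%N ->
  exists t0, [/\ tight r t0, (r <= content_length t0)%N, (t0.1.1 <= t.1.1)%N,
                 (t0.1.2 <= t.1.2)%N & (t0.2 <= t.2)%N].
Proof.
case: t => [[a b] c]; have [N] := ubnP (a + b + c); elim: N a b c => // N IH a b c.
rewrite ltnS => le_N le_r; have [ok | not_tight] := boolP (tight r (a, b, c)).
  by exists (a, b, c).
have : [\/ (0 < a) && (r <= 20 * a.-1 + 10 * b + 4 * c),
     (0 < b) && (r <= 20 * a + 10 * b.-1 + 4 * c) |
     (0 < c) && (r <= 20 * a + 10 * b + 4 * c.-1)]%N.
  move: not_tight le_r; rewrite /tight /content_length => H1 H2.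
  have [h|h] := boolP ((0 < a) && (r <= 20 * a.-1 + 10 * b + 4 * c))%N; first by apply: Or31.
  have [h'|h'] := boolP ((0 < b) && (r <= 20 * a + 10 * b.-1 + 4 * c))%N; first by apply: Or32.
  by apply: Or33; lia.
case=> /andP[pos le_r'].
- have [|//|t0 [? ? /= ? ? ?]] := IH a.-1 b c; first by lia.
  by exists t0; split=> //=; lia.
- have [|//|t0 [? ? /= ? ? ?]] := IH a b.-1 c; first by lia.
  by exists t0; split=> //=; lia.
have [|//|t0 [? ? /= ? ? ?]] := IH a b c.-1; first by lia.
by exists t0; split=> //=; lia.
Qed.

Lemma cols_free_trim (A : seq quad) s a b c c' : (c' <= c)%N ->
  cols_free condition_entry A (conditions (items s (a, b, c))) ->
  cols_free condition_entry A (conditions (items s (a, b, c'))).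
Proof.
move=> le_c; have [its ->] := items_prefix s a b le_c; rewrite /conditions map_cat flatten_cat.
exact: cols_free_prefix.
Qed.

Lemma pure_length m t : t \in pure_contents m -> content_length t = (20 * m)%N.
Proof.
case/flattenP => ts /mapP[i]; rewrite mem_iota => i_lt -> /mapP[j].
by rewrite mem_iota => j_lt -> /=; lia.
Qed.

Lemma sum_nth (T : Type) (t0 : T) (f : T -> nat) (s : seq T) :
  (\sum_(k < size s) f (nth t0 s k))%N = sumn (map f s).
Proof. by rewrite sumnE big_map (big_nth t0) big_mkord. Qed.

(** * From a verified configuration to maximal rank for all [x], [y], [z] *)

Section Configuration.
Variables (d : nat) (ls : seq (N * N * N * N)) (ms ss : seq nat) (r : nat).
Hypotheses (d3 : (3 <= d)%N) (d13 : (d <= 13)%N) (ok : config_ok d ls ms ss r).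

Let t0 : content := (0, 0, 0)%N.
Let c k := cell (owners ls d) k.

Let sz_ls : size ls = (size ms).+1.
Proof. by case/and5P: ok => /eqnP. Qed.

Let total : (20 * sumn ms + r)%N = 'C(d + 3, 3).
Proof. by case/and5P: ok => _ /eqnP. Qed.

Let r20 : (20 <= r)%N.
Proof. by case/and5P: ok. Qed.

Let owned a : a \in monomials d -> (owner ls a < size ls)%N.
Proof.
move=> a_in; case/and5P: ok => _ _ _ own _.
exact: (allP own (owner ls a, a) (map_f (fun a => (owner ls a, a)) a_in)).
Qed.

Let cell_free n k s ts : cell_ok (owners ls d) n k s ts -> forall t, t \in ts ->
  ((content_length t <= n)%N -> cols_free condition_entry (c k) (conditions (items s t))) /\
  ((n <= content_length t)%N -> rows_free condition_entry (c k) (conditions (items s t))).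
Proof.
by case/andP => /eqnP <- /allP all_ok t /all_ok; apply: content_ok_sound.
Qed.

Let pure_free k t : (k < size ms)%N -> t \in pure_contents (nth 0%N ms k) ->
  cols_free condition_entry (c k) (conditions (items (nth 0%N ss k) t)) /\
  rows_free condition_entry (c k) (conditions (items (nth 0%N ss k) t)).
Proof.
move=> lt_k t_in; case/and5P: ok => _ _ _ _ /andP[/allP pure _].
have /cell_free/(_ t t_in) := pure k (ltac:(by rewrite mem_iota)).
by rewrite (pure_length t_in) leqnn => -[cols rows]; split; [apply: cols | apply: rows].
Qed.

Let mixed_free t : tight r t ->
  ((content_length t <= r)%N ->
     cols_free condition_entry (c (size ms)) (conditions (items (nth 0%N ss (size ms)) t))) /\
  ((r <= content_length t)%N ->
     rows_free condition_entry (c (size ms)) (conditions (items (nth 0%N ss (size ms)) t))).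
Proof.
move=> /tight_mem t_in; case/and5P: ok => _ _ _ _ /andP[_ /cell_free].
exact.
Qed.

Variables (K : fieldType) (K0 : [pchar K] =i pred0) (x y z : nat).

Let rank_place (na nb nc : nat -> nat) :
  (\sum_(k < size ls) na k = x)%N -> (\sum_(k < size ls) nb k = y)%N ->
  (\sum_(k < size ls) nc k = z)%N ->
  ((forall k, (k < size ls)%N -> cols_free condition_entry (c k)
      (conditions (items (nth 0%N ss k) (na k, nb k, nc k)))) ->
   exists P, (20 * x + 10 * y + 4 * z <= \rank (@interp_mx K d x y z P))%N) /\
  ((forall k, (k < size ls)%N -> rows_free condition_entry (c k)
      (conditions (items (nth 0%N ss k) (na k, nb k, nc k)))) ->
   exists P, ('C(d + 3, 3) <= \rank (@interp_mx K d x y z P))%N).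
Proof.
move=> sum_a sum_b sum_c; pose ps := place (size ls) ss na nb nc.
have ps_mult : [seq t.1.1 | t <- ps] = nseq x 4 ++ nseq y 3 ++ nseq z 2.
  by rewrite !map_cat !block_mult sum_a sum_b sum_c.
have ps_cell t : t \in ps -> (t.1.2 < size ls)%N.
  by rewrite !mem_cat => /or3P[] /block_cell.
split=> free.
  rewrite -lengthYE.
  apply: (interp_degenerate K0 (isT : prime 31) (limit_weight_min ps_mult ps_cell)).
  apply: limit_rank_cols => // k lt_k; rewrite place_filter //; exact: free.
rewrite -card_Mon.
apply: (interp_degenerate K0 (isT : prime 31) (limit_weight_min ps_mult ps_cell)).
apply: limit_rank_rows => // k lt_k; rewrite place_filter //; exact: free.
Qed.

(** Too few conditions are completed by auxiliary 2-points, distributed, and trimmed again. With too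
    many conditions, the surplus goes to the last cell, where a smaller tight content already has
    full rank. *)
Lemma config_rank :
  exists P, (minn (20 * x + 10 * y + 4 * z) 'C(d + 3, 3) <= \rank (@interp_mx K d x y z P))%N.
Proof.
have [le_N | /ltnW ge_N] := leqP (20 * x + 10 * y + 4 * z)%N 'C(d + 3, 3).
  rewrite -total in le_N.
  (* With these added 2-points fewer than 4 conditions are missing: as [r] is at least 20, this
     gives the slack needed by [fill_cells], and the last content becomes tight. *)
  set z' := (z + (20 * sumn ms + r - (20 * x + 10 * y + 4 * z)) %/ 4)%N.
  have [|cs [a [b [e [sz pure xE yE [zE lenE]]]]]] := @fill_cells ms x y z'.
    by rewrite /z'; lia.
  have len_cs : content_length (a, b, e) = (20 * x + 10 * y + 4 * z' - 20 * sumn ms)%N.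
    by rewrite /content_length; lia.
  pose cs1 := rcons cs (a, b, e).
  (* Back to [z] 2-points: independence survives their removal from any of the cells. *)
  have [|s' [sz' le_s' sum_s']] := @trim [seq t.2 | t <- cs1] z.
    by rewrite map_rcons sumn_rcons -zE /z' leq_addr.
  have sz_cs1 : size cs1 = size ls by rewrite size_rcons sz sz_ls.
  have [||| col _] := @rank_place (fun k => (nth t0 cs1 k).1.1) (fun k => (nth t0 cs1 k).1.2)
    (fun k => nth 0%N s' k).
  - by rewrite -sz_cs1 (sum_nth t0 (fun t => t.1.1)) map_rcons sumn_rcons.
  - by rewrite -sz_cs1 (sum_nth t0 (fun t => t.1.2)) map_rcons sumn_rcons.
  - by rewrite -sz_cs1 -(size_map (fun t => t.2) cs1) -sz' (sum_nth 0%N id) map_id.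
  apply: col => k lt_k.
  have le_c : (nth 0 s' k <= (nth t0 cs1 k).2)%N.
    by have := le_s' k; rewrite (nth_map t0) // sz_cs1.
  apply: (cols_free_trim le_c).
  have -> : ((nth t0 cs1 k).1.1, (nth t0 cs1 k).1.2, (nth t0 cs1 k).2) = nth t0 cs1 k.
    by case: (nth t0 cs1 k) => [[]].
  rewrite sz_ls ltnS leq_eqVlt in lt_k; rewrite nth_rcons sz.
  case/predU1P: lt_k => [-> | lt_k]; last first.
    by rewrite lt_k; have [] := pure_free lt_k (pure k lt_k).
  rewrite ltnn eqxx.
  have [|free _] := @mixed_free (a, b, e); last by apply: free; rewrite len_cs /z'; lia.
  by rewrite /tight len_cs /z'; lia.
rewrite -total in ge_N.
have [|cs [a [b [e [sz pure xE yE [zE lenE]]]]]] := @fill_cells ms x y z; first by lia.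
(* Only tight contents were computed; further points merely add conditions to a block whose rows are
   already independent. *)
have [|t [t_ok len_t le_a le_b le_e]] := @tight_below r (a, b, e).
  by rewrite /content_length; lia.
pose cs1 := rcons cs (a, b, e).
have sz_cs1 : size cs1 = size ls by rewrite size_rcons sz sz_ls.
have [||| _ row] := @rank_place (fun k => (nth t0 cs1 k).1.1) (fun k => (nth t0 cs1 k).1.2)
  (fun k => (nth t0 cs1 k).2).
- by rewrite -sz_cs1 (sum_nth t0 (fun t => t.1.1)) map_rcons sumn_rcons.
- by rewrite -sz_cs1 (sum_nth t0 (fun t => t.1.2)) map_rcons sumn_rcons.
- by rewrite -sz_cs1 (sum_nth t0 (fun t => t.2)) map_rcons sumn_rcons.
apply: row => k lt_k.
have -> : ((nth t0 cs1 k).1.1, (nth t0 cs1 k).1.2, (nth t0 cs1 k).2) = nth t0 cs1 k.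
  by case: (nth t0 cs1 k) => [[]].
rewrite sz_ls ltnS leq_eqVlt in lt_k; rewrite nth_rcons sz.
case/predU1P: lt_k => [-> | lt_k]; last first.
  by rewrite lt_k; have [] := pure_free lt_k (pure k lt_k).
rewrite ltnn eqxx; have [_ /(_ len_t)] := mixed_free t_ok.
by apply: rows_free_sub; case: t le_a le_b le_e {t_ok len_t} => [[a' b'] e']; exact: items_sub.
Qed.
End Configuration.

(** * Computation for the five degrees, and the conclusion for general points *)

Lemma config9 : config_ok 9 weights9 sizes9 seeds9 60.
Proof. by vm_compute. Qed.

Lemma config10 : config_ok 10 weights10 sizes10 seeds10 66.
Proof. by vm_compute. Qed.

Lemma config11 : config_ok 11 weights11 sizes11 seeds11 84.
Proof. by vm_compute. Qed.

Lemma config12 : config_ok 12 weights12 sizes12 seeds12 75.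
Proof. by vm_compute. Qed.

Lemma config13 : config_ok 13 weights13 sizes13 seeds13 60.
Proof. by vm_compute. Qed.

Local Close Scope ring_scope.

Theorem theorem4p1 (K : closedFieldType) (hK : ([pchar K] =i pred0)%R)
    (d x y z : nat) (hd1 : (9 <= d)%N) (hd2 : (d <= 13)%N) :
  general (fun v : 'I_(x + y + z) * 'I_4 -> K =>
    let P := fun j i => v (j, i) in
    ((20 * x + 10 * y + 4 * z <= 'C(d + 3, 3))%N -> @h1_IY K d x y z P = 0%N) /\
    ((20 * x + 10 * y + 4 * z >= 'C(d + 3, 3))%N -> @h0_IY K d x y z P = 0%N)).
Proof.
have [P rkP] : exists P, (minn (20 * x + 10 * y + 4 * z) 'C(d + 3, 3)
    <= \rank (@interp_mx K d x y z P))%N.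
  have d3 : (3 <= d)%N by apply: leq_trans hd1.
  have : d \in [:: 9; 10; 11; 12; 13]%N by rewrite !inE; lia.
  rewrite !inE; case/or4P=> [||| /orP[]] /eqP dE; subst d.
  - exact: (config_rank d3 hd2 config9 hK x y z).
  - exact: (config_rank d3 hd2 config10 hK x y z).
  - exact: (config_rank d3 hd2 config11 hK x y z).
  - exact: (config_rank d3 hd2 config12 hK x y z).
  - exact: (config_rank d3 hd2 config13 hK x y z).
(* The rank bound at the single point set [P] spreads to a nonempty open set. *)
have [G [Gnz Gok]] := general_rank (v0 := fun ji => P ji.1 ji.2) (@polyfun_interp K d x y z) rkP.
by exists G; split=> // v /Gok; exact: postulation_of_rank.
Qed.
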